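(* Let $f:\mathbb{R}^{m\times n}\to\mathbb{R}\cup\{\infty\}$ be defined by $$f(X):=\sum_{k=1}^pf_k(X)+\|X\|_*,$$ where each $f_k:\mathbb{R}^{m\times n}\to\mathbb{R}\cup\{\infty\}$ is a proper closed LMI-representable function, and let $A^k_{00},A^k_0,A^k_{ij}$ ($i=1,\dots,m$, $j=1,\dots,n$) be symmetric matrices (for each $k$, all of the same size) such that $$\operatorname{epi}f_k=\Big\{(X,t):\ A^k_{00}+\sum_{i=1}^m\sum_{j=1}^nA^k_{ij}X_{ij}+A^k_0t\succeq0\Big\}.$$ Suppose in addition that there exist $X^s\in\mathbb{R}^{m\times n}$ and $s^s\in\mathbb{R}^p$ such that for $k=1,\dots,p$, $$A^k_{00}+\sum_{i=1}^m\sum_{j=1}^nA^k_{ij}X^s_{ij}+A^k_0s^s_k\succ0.$$ If $\bar X\in\operatorname{dom}\partial f$ satisfies $0\in\operatorname{ri}\partial f(\bar X)$, then $f$ satisfies the KL property at $\bar X$ with exponent $\frac12$.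
   Context: $\|X\|_*$ is the nuclear norm (sum of all singular values of $X$). $\mathbb{R}^{m\times n}$ carries the trace inner product and Frobenius norm. $\succeq0$ (resp. $\succ0$) means positive semidefinite (resp. definite). $\operatorname{epi}h:=\{(X,t):h(X)\le t\}$; $h$ is LMI-representable if its epigraph has the displayed linear-matrix-inequality form. $\operatorname{ri}$ is relative interior. A function $h:\mathbb{X}\to\mathbb{R}\cup\{\infty\}$ is proper if $\operatorname{dom}h:=\{x:h(x)<\infty\}\neq\emptyset$, and closed if it is lower semicontinuous. The regular subdifferential of a proper $h$ at $x\in\operatorname{dom}h$ is $\hat\partial h(x)=\{\zeta:\liminf_{z\to x,z\ne x}\frac{h(z)-h(x)-\langle\zeta,z-x\rangle}{\|z-x\|}\ge0\}$; the (limiting) subdifferential is $\partial h(x)=\{\zeta:\exists\,x^k\to x,\ h(x^k)\to h(x),\ \zeta^k\to\zeta,\ \zeta^k\in\hat\partial h(x^k)\}$ (the usual convex subdifferential when $h$ is convex); both are empty for $x\notin\operatorname{dom}h$, and $\operatorname{dom}\partial h:=\{x:\partial h(x)\ne\emptyset\}$. Write $\operatorname{dist}(x,D):=\inf_{y\in D}\|x-y\|$ (with value $\infty$ if $D=\emptyset$). A proper closed $h$ satisfies the Kurdyka-Łojasiewicz (KL) property at $\hat x\in\operatorname{dom}\partial h$ with exponent $\alpha\in[0,1)$ if there exist $a\in(0,\infty]$, a neighborhood $V$ of $\hat x$ and $\bar c>0$ such that, with $\varphi(s)=\bar c s^{1-\alpha}$, $\varphi'(h(x)-h(\hat x))\operatorname{dist}(0,\partial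 h(x))\ge1$ for every $x\in V$ with $h(\hat x)<h(x)<h(\hat x)+a$. *)

(* Defs.v *)
From HB Require Import structures.
From mathcomp Require Import all_boot all_order all_algebra.
From mathcomp Require Import polyrcf.
From mathcomp Require Import all_classical all_reals all_analysis.

Set Implicit Arguments.
Unset Strict Implicit.
Unset Printing Implicit Defensive.

Import Order.TTheory GRing.Theory Num.Theory.
Import numFieldNormedType.Exports.

Local Open Scope classical_set_scope.
Local Open Scope ring_scope.

(* The canonical norm of a matrix in the library is the max norm, so the
   Euclidean structure is introduced separately; the two norms induce the same
   topology, and the library's topology is the one used for neighborhoods and
   limits. *)
Definition frob_inner (R : realType) (m n : nat) (X Y : 'M[R]_(m, n)) : R :=
  \tr (X^T *m Y).

Definition frob_norm (R : realType) (m n : nat) (X : 'M[R]_(m, n)) : R :=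
  Num.sqrt (frob_inner X X).

(* Square roots of the eigenvalues of X^T X, repeated according to their
   multiplicity as roots of the characteristic polynomial. The list has n
   entries; when m < n this is the usual list of min(m, n) singular values
   padded with n - m zeros. *)
Definition singular_values (R : realType) (m n : nat) (X : 'M[R]_(m, n)) :
    seq R :=
  let p := char_poly (X^T *m X) in
  flatten [seq nseq (mup a p) (Num.sqrt a) | a <- rootsR p].

Definition nuclear_norm (R : realType) (m n : nat) (X : 'M[R]_(m, n)) : R :=
  \sum_(s <- singular_values X) s.

Definition psdmx (R : realType) (d : nat) (A : 'M[R]_d) : Prop :=
  A \is symmetricmx /\ forall v : 'cV[R]_d, 0 <= (v^T *m A *m v) 0 0.

Definition pdmx (R : realType) (d : nat) (A : 'M[R]_d) : Prop :=
  A \is symmetricmx /\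
  forall v : 'cV[R]_d, v != 0 -> 0 < (v^T *m A *m v) 0 0.

Definition lmi (R : realType) (m n d : nat) (A00 : 'M[R]_d)
    (A : 'I_m -> 'I_n -> 'M[R]_d) (A0 : 'M[R]_d)
    (X : 'M[R]_(m, n)) (t : R) : 'M[R]_d :=
  A00 + \sum_(i < m) \sum_(j < n) X i j *: A i j + t *: A0.

(* Functions into R \cup {oo} are functions into \bar R that never take the
   value -oo; this requirement is part of properness. *)
Definition proper_fun (R : realType) (m n : nat) (h : 'M[R]_(m, n) -> \bar R) :
    Prop :=
  (forall X, h X != -oo%E) /\ exists X, (h X < +oo)%E.

Definition epi (R : realType) (m n : nat) (h : 'M[R]_(m, n) -> \bar R) :
    set ('M[R]_(m, n) * R) :=
  [set q | (h q.1 <= q.2%:E)%E].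

Definition regular_subdiff (R : realType) (m n : nat)
    (h : 'M[R]_(m, n) -> \bar R) (X : 'M[R]_(m, n)) : set 'M[R]_(m, n) :=
  [set G | (h X < +oo)%E /\
    (0 <= limf_einf (fun Z => (h Z - h X - (frob_inner G (Z - X))%:E)
                              / (frob_norm (Z - X))%:E) X^')%E].

Definition subdiff (R : realType) (m n : nat)
    (h : 'M[R]_(m, n) -> \bar R) (X : 'M[R]_(m, n)) : set 'M[R]_(m, n) :=
  [set G | (h X < +oo)%E /\
    exists (Xs Gs : nat -> 'M[R]_(m, n)),
      [/\ Xs k @[k --> \oo] --> X,
          h (Xs k) @[k --> \oo] --> h X,
          Gs k @[k --> \oo] --> G
        & forall k, regular_subdiff h (Xs k) (Gs k)]].

Definition dom_subdiff (R : realType) (m n : nat)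
    (h : 'M[R]_(m, n) -> \bar R) : set 'M[R]_(m, n) :=
  [set X | subdiff h X !=set0].

Definition affine_hull (R : realType) (m n : nat) (C : set 'M[R]_(m, n)) :
    set 'M[R]_(m, n) :=
  [set Y | exists (k : nat) (l : 'I_k -> R) (P : 'I_k -> 'M[R]_(m, n)),
    [/\ forall i, C (P i), \sum_(i < k) l i = 1
      & Y = \sum_(i < k) l i *: P i]].

Definition relint (R : realType) (m n : nat) (C : set 'M[R]_(m, n)) :
    set 'M[R]_(m, n) :=
  [set X | C X /\ \forall Y \near X, affine_hull C Y -> C Y].

(* The infimum of the empty set is +oo in \bar R. *)
Definition dist_set (R : realType) (m n : nat) (X : 'M[R]_(m, n))
    (D : set 'M[R]_(m, n)) : \bar R :=
  ereal_inf [set (frob_norm (X - Y))%:E | Y in D].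

(* The standing requirements (h proper and closed, Xh in dom (subdiff h),
   0 <= alpha < 1) are included in the property. *)
Definition KL_property (R : realType) (m n : nat)
    (h : 'M[R]_(m, n) -> \bar R) (Xh : 'M[R]_(m, n)) (alpha : R) : Prop :=
  [/\ proper_fun h, lower_semicontinuous h, dom_subdiff h Xh, 0 <= alpha < 1
    & exists (a : \bar R) (c : R), [/\ (0 < a)%E, 0 < c
      & let phi := fun s : R => c * s `^ (1 - alpha) in
        \forall X \near Xh, (h Xh < h X)%E -> (h X < h Xh + a)%E ->
          (1 <= (derive1 phi (fine (h X - h Xh)%E))%:E
                * dist_set 0 (subdiff h X))%E]].

(* Main.v *)
(* The nuclear norm is the minimum of (tr U + tr V) / 2 over the U, V making
   [U X; X^T V] positive semidefinite, so f is the projection of a linear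
   function c over a spectrahedron L + B w >= 0, where w = 0 lifts the minimizer
   Xbar. Let P project onto ker L. Perturbing by the Slater point, every w with
   P (B w) P >= 0 satisfies <G, pi w> <= c w for all subgradients G at Xbar. As 0
   is in the relative interior of the subdifferential, c w = 0 forces <G, pi w> = 0
   for all of them, hence P (B w) P = 0 by a multiplier that is definite on ker L;
   by compactness, c w >= lambda tr (P (B w) P). For a feasible w with
   c w = f X - f Xbar = e, the matrix S = L + B w then has tr (P S P) = O(e), hence
   |S P| = O(sqrt e), and a linear correction of w of size O(sqrt e), followed by a
   small step towards Xbar, gives a minimizer X' with |X - X'| = O(sqrt e). Finally
   e <= <G, X - X'> for every G in the subdifferential of f at X. *)

Require Import Defs.
From HB Require Import structures.
From mathcomp Require Import all_boot all_order all_algebra.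
From mathcomp Require Import all_classical all_reals all_analysis.
From mathcomp Require Import ring lra polyrcf.

Import Order.TTheory GRing.Theory Num.Theory.
Import numFieldNormedType.Exports.

Local Open Scope classical_set_scope.
Local Open Scope ring_scope.

Set Implicit Arguments.
Unset Strict Implicit.
Unset Printing Implicit Defensive.

(** * The trace inner product *)

Section Inner.
Context {R : realType}.

(** Error bounds for linear matrix inequalities are in general of Hölder type, with an exponent that
    deteriorates with each facial reduction step; the exponent 1/2 is available because here a
    single multiplier exposes the face of minimizers. That multiplier does not belong to the
    subgradient 0. One that is definite on ker L is written down explicitly, from scaled kernel
    projections for the fk and the polar factor for the nuclear norm, and it certifies whatever
    subgradient G is left over. The relative interior condition then supplies a negative multiple of
    G as a subgradient, and the two together pin <G, pi w> to 0. The scaling needs <P, A0> > 0 on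
    each block, a second use of the minimality of Xbar and of the Slater point. The square root has
    one source, |S P|^2 <= tr S * tr (P S P). This requires a bound on tr S, although neighborhoods
    of Xbar do not control the lift variables directly; the bound comes from a positive definite
    multiplier built in the same way. *)

Lemma frob_innerE m n (X Y : 'M[R]_(m, n)) :
  frob_inner X Y = \sum_i \sum_j X i j * Y i j.
Proof.
rewrite /frob_inner /mxtrace exchange_big /=; apply: eq_bigr => j _.
by rewrite mxE; apply: eq_bigr => i _; rewrite mxE.
Qed.

Lemma frob_innerC m n (X Y : 'M[R]_(m, n)) : frob_inner X Y = frob_inner Y X.
Proof. by rewrite /frob_inner -mxtrace_tr trmx_mul trmxK. Qed.

Lemma frob_inner_is_linear m n (X : 'M[R]_(m, n)) : linear_for *%R (frob_inner X).
Proof.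
by move=> a Y Z; rewrite /frob_inner mulmxDr -scalemxAr mxtraceD mxtraceZ.
Qed.

HB.instance Definition _ m n (X : 'M[R]_(m, n)) :=
  GRing.isLinear.Build R 'M[R]_(m, n) R *%R (frob_inner X)
    (frob_inner_is_linear X).

Lemma frob_innerDl m n (X Y Z : 'M[R]_(m, n)) :
  frob_inner (X + Y) Z = frob_inner X Z + frob_inner Y Z.
Proof. by rewrite !(frob_innerC _ Z) linearD. Qed.

Lemma frob_innerDr m n (X Y Z : 'M[R]_(m, n)) :
  frob_inner X (Y + Z) = frob_inner X Y + frob_inner X Z.
Proof. exact: linearD. Qed.

Lemma frob_innerZl m n a (X Y : 'M[R]_(m, n)) :
  frob_inner (a *: X) Y = a * frob_inner X Y.
Proof. by rewrite !(frob_innerC _ Y) linearZ. Qed.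

Lemma frob_innerZr m n a (X Y : 'M[R]_(m, n)) :
  frob_inner X (a *: Y) = a * frob_inner X Y.
Proof. exact: linearZ. Qed.

Lemma frob_innerNl m n (X Y : 'M[R]_(m, n)) :
  frob_inner (- X) Y = - frob_inner X Y.
Proof. by rewrite !(frob_innerC _ Y) linearN. Qed.

Lemma frob_innerNr m n (X Y : 'M[R]_(m, n)) :
  frob_inner X (- Y) = - frob_inner X Y.
Proof. exact: linearN. Qed.

Lemma frob_inner0l m n (X : 'M[R]_(m, n)) : frob_inner 0 X = 0.
Proof. by rewrite frob_innerC linear0. Qed.

Lemma frob_inner0r m n (X : 'M[R]_(m, n)) : frob_inner X 0 = 0.
Proof. exact: linear0. Qed.

Lemma frob_inner_sumr m n (I : finType) (X : 'M[R]_(m, n)) (Y : I -> 'M[R]_(m, n)) :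
  frob_inner X (\sum_i Y i) = \sum_i frob_inner X (Y i).
Proof. exact: linear_sum. Qed.

Lemma frob_inner_suml m n (I : finType) (X : 'M[R]_(m, n)) (Y : I -> 'M[R]_(m, n)) :
  frob_inner (\sum_i Y i) X = \sum_i frob_inner (Y i) X.
Proof.
by rewrite frob_innerC frob_inner_sumr; apply: eq_bigr => i _; exact: frob_innerC.
Qed.

Lemma frob_inner_mull m n k (A : 'M[R]_(m, n)) (X : 'M[R]_(n, k)) Y :
  frob_inner (A *m X) Y = frob_inner X (A^T *m Y).
Proof. by rewrite /frob_inner trmx_mul mulmxA. Qed.

Lemma frob_inner_ge0 m n (X : 'M[R]_(m, n)) : 0 <= frob_inner X X.
Proof.
rewrite frob_innerE; apply: sumr_ge0 => i _; apply: sumr_ge0 => j _.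
by rewrite -expr2 sqr_ge0.
Qed.

Lemma frob_inner_eq0 m n (X : 'M[R]_(m, n)) : (frob_inner X X == 0) = (X == 0).
Proof.
apply/eqP/eqP => [|->]; last exact: frob_inner0l.
rewrite frob_innerE => /eqP.
rewrite psumr_eq0; last first.
  by move=> i _; apply: sumr_ge0 => j _; rewrite -expr2 sqr_ge0.
move=> /allP H; apply/matrixP => i j; rewrite mxE.
have := H i (mem_index_enum _); rewrite /= psumr_eq0; last first.
  by move=> k _; rewrite -expr2 sqr_ge0.
by move=> /allP /(_ j (mem_index_enum _)) /=; rewrite -expr2 sqrf_eq0 => /eqP.
Qed.

Lemma frob_inner_gt0 m n (X : 'M[R]_(m, n)) : (0 < frob_inner X X) = (X != 0).
Proof. by rewrite lt_def frob_inner_ge0 andbT frob_inner_eq0. Qed.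

Lemma frob_norm_ge0 m n (X : 'M[R]_(m, n)) : 0 <= frob_norm X.
Proof. exact: sqrtr_ge0. Qed.

Lemma frob_norm_sqr m n (X : 'M[R]_(m, n)) : frob_norm X ^+ 2 = frob_inner X X.
Proof. by rewrite sqr_sqrtr // frob_inner_ge0. Qed.

Lemma frob_normZ m n a (X : 'M[R]_(m, n)) :
  frob_norm (a *: X) = `|a| * frob_norm X.
Proof.
rewrite /frob_norm frob_innerZl frob_innerZr mulrA -expr2 sqrtrM ?sqr_ge0 //.
by rewrite sqrtr_sqr.
Qed.

Lemma frob_normN m n (X : 'M[R]_(m, n)) : frob_norm (- X) = frob_norm X.
Proof. by rewrite /frob_norm frob_innerNl frob_innerNr opprK. Qed.

Lemma frob_norm_gt0 m n (X : 'M[R]_(m, n)) : (0 < frob_norm X) = (X != 0).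
Proof. by rewrite sqrtr_gt0 frob_inner_gt0. Qed.

Lemma nonneg_quadratic_disc (a b c : R) : 0 <= c ->
  (forall t, 0 <= a + t * b *+ 2 + t ^+ 2 * c) -> b ^+ 2 <= a * c.
Proof.
move=> c0 H; have [c_eq0|c_neq0] := eqVneq c 0; last first.
  have := H (- (b / c)).
  have -> : a + - (b / c) * b *+ 2 + (- (b / c)) ^+ 2 * c = a - b ^+ 2 / c.
    by field.
  by rewrite subr_ge0 ler_pdivrMr // lt_def c_neq0.
rewrite c_eq0 mulr0; have [->|b0] := eqVneq b 0; first by rewrite expr0n.
(* With [c = 0] the expression is affine in [t]; this [t] gives it the value -1. *)
have := H (- ((a + 1) / (b *+ 2))).
rewrite c_eq0 mulr0 addr0.
have -> : a + - ((a + 1) / (b *+ 2)) * b *+ 2 = -1 by field.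
by rewrite lerNr oppr0 ler10.
Qed.

Lemma frob_cauchy_schwarz m n (X Y : 'M[R]_(m, n)) :
  frob_inner X Y <= frob_norm X * frob_norm Y.
Proof.
apply: (le_trans (ler_norm _)).
rewrite -sqrtr_sqr -sqrtrM ?frob_inner_ge0 // ler_sqrt ?mulr_ge0 ?frob_inner_ge0 //.
apply: nonneg_quadratic_disc; first exact: frob_inner_ge0.
move=> t; have := frob_inner_ge0 (X + t *: Y).
rewrite !frob_innerDl !frob_innerDr !frob_innerZl !frob_innerZr (frob_innerC Y X).
by move=> h; suff <- : frob_inner X X + t * frob_inner X Y +
   (t * frob_inner X Y + t * (t * frob_inner Y Y)) = frob_inner X X +
   t * frob_inner X Y *+ 2 + t ^+ 2 * frob_inner Y Y by []; ring.
Qed.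

Lemma frob_normD m n (X Y : 'M[R]_(m, n)) :
  frob_norm (X + Y) <= frob_norm X + frob_norm Y.
Proof.
rewrite -(ler_pXn2r (n:=2)) ?nnegrE ?addr_ge0 ?frob_norm_ge0 //.
rewrite sqrrD !frob_norm_sqr frob_innerDl !frob_innerDr (frob_innerC Y X).
have := frob_cauchy_schwarz X Y; lra.
Qed.

Lemma frob_norm_mulmx m n (A : 'M[R]_(m, n)) (v : 'cV[R]_n) :
  frob_norm (A *m v) <= frob_norm A * frob_norm v.
Proof.
rewrite -sqrtrM ?frob_inner_ge0 // ler_sqrt ?mulr_ge0 ?frob_inner_ge0 //.
rewrite !(frob_innerE A, frob_innerE (A *m v)) mulr_suml; apply: ler_sum => i _.
rewrite big_ord1 -expr2 mxE -[leRHS]mulrC.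
have := frob_cauchy_schwarz (row i A)^T v.
have := frob_cauchy_schwarz (- (row i A)^T) v.
rewrite frob_normN frob_innerNl.
have -> : frob_inner (row i A)^T v = \sum_j A i j * v j 0.
  by rewrite frob_innerE; apply: eq_bigr => j _; rewrite big_ord1 !mxE.
have <- : frob_norm (row i A)^T ^+ 2 = \sum_j A i j * A i j.
  by rewrite frob_norm_sqr frob_innerE; apply: eq_bigr => j _; rewrite big_ord1 !mxE.
rewrite -frob_norm_sqr -exprMn mulrC => h1 h2.
rewrite -real_normK ?num_real // ler_pXn2r ?nnegrE ?mulr_ge0 ?frob_norm_ge0 //.
by rewrite ler_norml h2 andbT lerNl.
Qed.

Lemma entry_le_frob m n (X : 'M[R]_(m, n)) i j : `|X i j| <= frob_norm X.
Proof.
rewrite -sqrtr_sqr ler_sqrt ?frob_inner_ge0 // frob_innerE.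
rewrite (bigD1 i) //= (bigD1 j) //= expr2 -addrA lerDl addr_ge0 //.
  by apply: sumr_ge0 => k _; rewrite -expr2 sqr_ge0.
by do 2![apply: sumr_ge0 => ? _]; rewrite -expr2 sqr_ge0.
Qed.

Lemma frob_le_entries m n (X : 'M[R]_(m, n)) (e : R) :
  (forall i j, `|X i j| <= e) -> frob_norm X <= Num.sqrt (m * n)%:R * e.
Proof.
(* A negative [e] is possible only for a matrix without entries, and then both sides are 0. *)
move=> H; have [e0|e0] := leP 0 e; last first.
  case: m n X H => [|m] [|n] X H.
  - by rewrite /frob_norm frob_innerE big_ord0 sqrtr0 ?mul0n ?sqrtr0 mul0r.
  - by rewrite /frob_norm frob_innerE big_ord0 sqrtr0 ?mul0n ?sqrtr0 mul0r.
  - rewrite /frob_norm frob_innerE big1 => [|i _]; last by rewrite big_ord0.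
    by rewrite sqrtr0 ?muln0 ?sqrtr0 mul0r.
  - by have := lt_le_trans e0 (le_trans (normr_ge0 _) (H 0 0)); rewrite ltxx.
rewrite -[e in leRHS](ger0_norm e0) -sqrtr_sqr -sqrtrM ?ler0n //.
rewrite ler_sqrt ?mulr_ge0 ?sqr_ge0 ?ler0n // frob_innerE.
apply: (le_trans (y := \sum_(i < m) \sum_(j < n) e ^+ 2)).
  apply: ler_sum => i _; apply: ler_sum => j _.
  rewrite -expr2 -real_normK ?num_real // ler_pXn2r ?nnegrE //.
by rewrite !sumr_const !card_ord -mulrnA mulr_natl mulnC.
Qed.

Lemma frob_norm_linear m n p q (g : {linear 'M[R]_(m, n) -> 'M[R]_(p, q)}) :
  exists2 C : R, 0 <= C & forall X, frob_norm (g X) <= C * frob_norm X.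
Proof.
exists (\sum_i \sum_j frob_norm (g (delta_mx i j))).
  by do 2![apply: sumr_ge0 => ? _]; exact: frob_norm_ge0.
move=> X; rewrite {1}(matrix_sum_delta X) linear_sum.
rewrite mulr_suml; elim/big_ind2 : _ => [|x1 y1 x2 y2 H1 H2|i _].
- by rewrite /frob_norm frob_inner0l sqrtr0.
- exact: le_trans (frob_normD _ _) (lerD H1 H2).
rewrite linear_sum mulr_suml; elim/big_ind2 : _ => [|x1 y1 x2 y2 H1 H2|j _].
- by rewrite /frob_norm frob_inner0l sqrtr0.
- exact: le_trans (frob_normD _ _) (lerD H1 H2).
rewrite linearZ frob_normZ mulrC ler_wpM2l ?frob_norm_ge0 //.
exact: entry_le_frob.
Qed.

Lemma continuous_coord m n (i : 'I_m) (j : 'I_n) :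
  continuous (fun X : 'M[R]_(m, n) => X i j).
Proof. exact: coord_continuous. Qed.

Lemma continuous_sumr (T : topologicalType) (I : finType) (F : I -> T -> R) :
  (forall i, continuous (F i)) -> continuous (fun x => \sum_i F i x).
Proof. by move=> H; apply: continuous_big => //; exact: add_continuous. Qed.

Lemma continuous_mulr (T : topologicalType) (f g : T -> R) :
  continuous f -> continuous g -> continuous (fun x => f x * g x).
Proof. by move=> cf cg x; apply: cvgM; [exact: cf | exact: cg]. Qed.

Lemma linear_mx_continuous m n (l : {linear 'M[R]_(m, n) -> R | *%R}) :
  continuous l.
Proof.
have -> : l = (fun X => \sum_i \sum_j X i j * l (delta_mx i j)) :> (_ -> _).
  apply/funext => X; rewrite {1}(matrix_sum_delta X) linear_sum.
  by apply: eq_bigr => i _; rewrite linear_sum; apply: eq_bigr => j _; rewrite linearZ.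
apply: continuous_sumr => i; apply: continuous_sumr => j.
apply: continuous_mulr; [exact: continuous_coord | exact: cst_continuous].
Qed.

Lemma closed_fun_eq (T : topologicalType) (f : T -> R) a :
  continuous f -> closed [set x | f x = a].
Proof.
move=> cf; apply: (@preimage_closed _ _ f [set y | y = a]).
  by move=> ? _; exact: cf.
by move=> t; exact: closed_eq.
Qed.

Lemma closed_fun_ge (T : topologicalType) (f : T -> R) a :
  continuous f -> closed [set x | a <= f x].
Proof.
move=> cf; apply: (@preimage_closed _ _ f [set y | a <= y]).
  by move=> ? _; exact: cf.
by move=> t; exact: closed_ge.
Qed.

Lemma mx_norm_le m n (X : 'M[R]_(m, n)) (e : R) : 0 <= e ->
  (forall i j, `|X i j| <= e) -> `|X| <= e.
Proof.
move=> e0 H; rewrite [leLHS]/Num.norm /= mx_normrE.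
by apply/bigmax_leP; split => //= -[i j] _ /=.
Qed.

Lemma entry_le_mx_norm m n (X : 'M[R]_(m, n)) i j : `|X i j| <= `|X|.
Proof.
rewrite [leRHS]/Num.norm /= mx_normrE; apply/bigmax_geP; right => /=.
by exists (i, j).
Qed.

End Inner.

(** * Positive semidefinite matrices and the spectral theorem *)

Section Psd.
Context {R : realType}.

Lemma symmetricmxE n (A : 'M[R]_n) : (A \is symmetricmx) = (A == A^T).
Proof. by rewrite is_hermitianmxE expr0 scale1r map_mx_id. Qed.

Lemma symmetricmxP n (A : 'M[R]_n) : reflect (A^T = A) (A \is symmetricmx).
Proof. by rewrite symmetricmxE; apply: (iffP eqP) => /esym. Qed.

Lemma qformE n (A : 'M[R]_n) (v : 'cV[R]_n) :
  (v^T *m A *m v) 0 0 = frob_inner v (A *m v).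
Proof. by rewrite /frob_inner mulmxA /mxtrace big_ord1. Qed.

Lemma psdmxP n (A : 'M[R]_n) :
  psdmx A <-> A^T = A /\ forall v : 'cV[R]_n, 0 <= frob_inner v (A *m v).
Proof.
by rewrite /psdmx; split => -[/symmetricmxP sA pA]; split => // v;
  have := pA v; rewrite qformE.
Qed.

Lemma psdmx_sym n (A : 'M[R]_n) : psdmx A -> A^T = A.
Proof. by case/psdmxP. Qed.

Lemma psdmx_form_ge0 n (A : 'M[R]_n) (v : 'cV[R]_n) :
  psdmx A -> 0 <= frob_inner v (A *m v).
Proof. by case/psdmxP. Qed.

Lemma pdmxP n (A : 'M[R]_n) : pdmx A <->
  A^T = A /\ forall v : 'cV[R]_n, v != 0 -> 0 < frob_inner v (A *m v).
Proof.
by rewrite /pdmx; split => -[/symmetricmxP sA pA]; split => // v v0;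
  have := pA v v0; rewrite qformE.
Qed.

(** The form at [v + t A v] is a nonnegative quadratic polynomial in [t] without constant term, so
    its linear coefficient, a multiple of [|A v|^2], vanishes. *)
Lemma psd_kernel n (A : 'M[R]_n) (v : 'cV[R]_n) : psdmx A ->
  frob_inner v (A *m v) = 0 -> A *m v = 0.
Proof.
move=> /psdmxP[sA pA] v0.
have := @nonneg_quadratic_disc R 0 (frob_inner (A *m v) (A *m v))
  (frob_inner (A *m v) (A *m (A *m v))) (pA _).
rewrite mul0r => H; have {}H : frob_inner (A *m v) (A *m v) ^+ 2 <= 0.
  apply: H => t; have := pA (v + t *: (A *m v)).
  rewrite mulmxDr frob_innerDl !frob_innerDr v0 -scalemxAr !frob_innerZl.
  rewrite !frob_innerZr -[frob_inner v (A *m (A *m v))]frob_innerC.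
  rewrite frob_inner_mull sA.
  set a := frob_inner (A *m v) _; set b := frob_inner (A *m v) _.
  by suff -> : 0 + t * a + (t * a + t * (t * b)) = 0 + t * a *+ 2 + t ^+ 2 * b by []; ring.
apply/eqP; rewrite -frob_inner_eq0 -sqrf_eq0 eq_le H /=; exact: sqr_ge0.
Qed.

(* Maximizing the quadratic form over the unit sphere gives an eigenvector. *)
Lemma symmetric_eigenvector n (A : 'M[R]_n.+1) : A^T = A ->
  exists (v : 'cV[R]_n.+1) (a : R), frob_inner v v = 1 /\ A *m v = a *: v.
Proof.
move=> sA.
pose q (M : 'M[R]_n.+1) (v : 'rV[R]_n.+1) := frob_inner v^T (M *m v^T).
have q_cont M : continuous (q M).
  have -> : q M = fun v => \sum_i \sum_j (v 0 i * (M i j * v 0 j)).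
    apply/funext => v; rewrite /q frob_innerE; apply: eq_bigr => i _.
    rewrite big_ord1 !mxE mulr_sumr; apply: eq_bigr => j _.
    by rewrite !mxE.
  apply: continuous_sumr => i; apply: continuous_sumr => j.
  apply: continuous_mulr; first exact: continuous_coord.
  by apply: continuous_mulr; [exact: cst_continuous | exact: continuous_coord].
pose S : set 'rV[R]_n.+1 := [set v | q 1%:M v = 1].
have S0 : S !=set0.
  exists (delta_mx 0 0); rewrite /S /= /q mul1mx trmx_delta frob_innerE.
  rewrite (bigD1 0) //= big_ord1 mxE eqxx mulr1 big1 ?addr0 // => i /negPf i0.
  by rewrite big_ord1 mxE i0 mul0r.
have cS : closed S by apply: closed_fun_eq; exact: q_cont.
have bS : bounded_set S.
  exists 1; split => // M M1 v /= Sv.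
  apply: mx_norm_le => [|i j]; first by apply: ltW; apply: lt_trans M1.
  rewrite (ord1 i); apply: ltW; apply: le_lt_trans M1.
  have := entry_le_frob v^T j 0; rewrite mxE => /le_trans; apply.
  by move: Sv; rewrite /S /= /q mul1mx /frob_norm => ->; rewrite sqrtr1.
have [c cSin cmax] := EVT_max_rV S0 (bounded_closed_compact bS cS)
  (continuous_subspaceT (q_cont A)).
move: cSin; rewrite inE /S /= /q mul1mx => c1.
set v := c^T in c1 *; exists v; exists (q A c); split => //.
have vE : v = c^T by [].
(* Maximality makes [M] positive semidefinite with vanishing form at [v], so [psd_kernel] yields the
   eigenvalue equation without differentiating. *)
pose M := (q A c)%:M - A.
have sM : M^T = M by rewrite /M linearB /= tr_scalar_mx sA.
have pM : psdmx M.
  apply/psdmxP; split => // w; have [->|w0] := eqVneq w 0.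
    by rewrite frob_inner0l.
  have nw0 : 0 < frob_norm w by rewrite frob_norm_gt0.
  have := cmax ((frob_norm w)^-1 *: w^T).
  rewrite inE /S /= /q mul1mx [(_ *: _)^T]linearZ /= trmxK -!scalemxAr !frob_innerZl.
  rewrite !frob_innerZr -frob_norm_sqr => H.
  have {}H : (frob_norm w)^-1 * ((frob_norm w)^-1 * frob_inner w (A *m w))
      <= frob_inner c^T (A *m c^T).
    by apply: H; field; rewrite gt_eqF.
  rewrite /M mulmxBl mul_scalar_mx frob_innerDr frob_innerNr frob_innerZr.
  rewrite subr_ge0 -frob_norm_sqr /q.
  rewrite mulrA -invfM -expr2 mulrC ler_pdivrMr // in H.
  by rewrite exprn_gt0.
have /(psd_kernel pM) : frob_inner v (M *m v) = 0.
  rewrite /M mulmxBl mul_scalar_mx frob_innerDr frob_innerNr frob_innerZr c1.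
  by rewrite mulr1 subrr.
by move/eqP; rewrite /M mulmxBl mul_scalar_mx subr_eq0 => /eqP ->.
Qed.

(** The reflection [1 - 2 u u^T / |u|^2] with [u = v - e] swaps [v] and the first basis vector [e];
    when [v = e] it degenerates and the identity serves. *)
Lemma householder n (v : 'cV[R]_n.+1) : frob_inner v v = 1 ->
  exists H : 'M[R]_n.+1, [/\ H^T = H, H *m H = 1%:M & H *m delta_mx 0 0 = v].
Proof.
move=> v1; pose e : 'cV[R]_n.+1 := delta_mx 0 0.
have mul_outer (u x : 'cV[R]_n.+1) : u *m u^T *m x = frob_inner u x *: u.
  by rewrite -mulmxA [u^T *m x]mx11_scalar mul_mx_scalar /frob_inner /mxtrace big_ord1.
have [->|/negPf ve] := eqVneq v e.
  by exists 1%:M; rewrite trmx1 !mul1mx.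
pose u := v - e; have u0 : frob_inner u u != 0.
  by rewrite frob_inner_eq0 subr_eq0 ve.
have e1 : frob_inner e e = 1.
  rewrite frob_innerE (bigD1 0) //= big_ord1 mxE eqxx mulr1 big1 ?addr0 // => i.
  by move=> /negPf i0; rewrite big_ord1 mxE i0 mul0r.
pose k := 2 / frob_inner u u.
exists (1%:M - k *: (u *m u^T)); split.
- by rewrite linearB /= trmx1 linearZ /= trmx_mul trmxK.
- set G := k *: _; have GG : G *m G = 2 *: G.
    rewrite /G -scalemxAl -scalemxAr mulmxA mul_outer -scalemxAl !scalerA.
    by congr (_ *: _); rewrite /k; field.
  rewrite mulmxBl mul1mx mulmxBr mulmx1 GG opprB.
  by rewrite scaler_nat mulr2n addrK subrK.
- rewrite mulmxBl mul1mx -scalemxAl mul_outer scalerA.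
  have -> : k * frob_inner u e = -1.
    have uu : frob_inner u u = - 2 * frob_inner u e.
      rewrite /u !(frob_innerDl, frob_innerDr, frob_innerNl, frob_innerNr).
      by rewrite v1 e1 (frob_innerC e v); ring.
    by rewrite /k {1}uu; field; move: u0; rewrite uu mulf_eq0 negb_or => /andP[].
  by rewrite scaleN1r opprK /u addrC subrK.
Qed.

(** Deflation: after conjugation by the reflection the first column is a multiple of the first basis
    vector, so by symmetry a 1 by 1 block splits off and induction applies to the other block. *)
Theorem symmetric_spectral n (A : 'M[R]_n) : A^T = A ->
  exists (Q : 'M[R]_n) (d : 'rV[R]_n),
    Q^T *m Q = 1%:M /\ A = Q *m diag_mx d *m Q^T.
Proof.
elim: n A => [|n IH] A sA.
  by exists 1%:M, 0; rewrite trmx1 mul1mx; split => //; apply/matrixP => -[].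
have [v [a [v1 Av]]] := symmetric_eigenvector sA.
have [H [sH HH He]] := householder v1.
have Hv : H *m v = delta_mx 0 0 by rewrite -He mulmxA HH mul1mx.
have [A' A'def] : exists A' : 'M[R]_(1 + n), A' = H *m A *m H by exists (H *m A *m H).
have sA' : A'^T = A' by rewrite A'def !trmx_mul sH sA mulmxA.
have A'e : A' *m delta_mx 0 0 = a *: (delta_mx 0 0 : 'cV[R]_(1 + n)).
  by rewrite A'def -!mulmxA He Av -scalemxAr Hv.
have col0 i : A' i 0 = a * (i == 0)%:R.
  by have /matrixP/(_ i 0) := A'e; rewrite -colE !mxE eqxx andbT.
have sB : (drsubmx A')^T = drsubmx A' by rewrite trmx_drsub sA'.
have [Q [d [QQ BE]]] := IH _ sB.
have A'E : A' = block_mx a%:M 0 0 (drsubmx A').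
  rewrite -[LHS]submxK; congr block_mx.
  - apply/matrixP => i j; rewrite !mxE !ord1 lshift0 col0 eqxx mulr1 //.
  - apply/matrixP => i j; rewrite -sA' !mxE !ord1 lshift0 col0.
    by rewrite (_ : rshift 1 j == 0 = false) ?mulr0.
  - apply/matrixP => i j; rewrite !mxE !ord1 lshift0 col0.
    by rewrite (_ : rshift 1 i == 0 = false) ?mulr0.
pose Q1 : 'M[R]_(1 + n) := block_mx 1%:M 0 0 Q.
have Q1T : Q1^T = block_mx 1%:M 0 0 Q^T.
  by rewrite /Q1 (tr_block_mx (1%:M : 'M[R]_1) 0 0 Q) !trmx0 trmx1.
exists (H *m Q1), (row_mx a%:M d); split.
  rewrite trmx_mul sH mulmxA -[X in X *m _]mulmxA HH mulmx1 Q1T.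
  rewrite (mulmx_block (1%:M : 'M[R]_1) 0 0 Q^T (1%:M : 'M[R]_1) 0 0 Q).
  rewrite !(mul0mx, mulmx0, addr0, add0r, mul1mx) QQ.
  by rewrite -scalar_mx_block.
have -> : A = H *m A' *m H by rewrite A'def !mulmxA HH mul1mx -mulmxA HH mulmx1.
rewrite trmx_mul sH A'E BE Q1T.
have -> : diag_mx (row_mx a%:M d) = block_mx a%:M 0 0 (diag_mx d) :> 'M[R]_(1 + n).
  by rewrite diag_mx_row; congr block_mx; apply/matrixP => i j; rewrite !ord1 !mxE.
rewrite !mulmxA; congr (_ *m _); rewrite -!mulmxA; congr (_ *m _).
rewrite /Q1 (mulmx_block (a%:M : 'M[R]_1) 0 0 (diag_mx d) (1%:M : 'M[R]_1) 0 0 Q^T).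
rewrite !(mul0mx, mulmx0, addr0, add0r, mulmx1).
have := mulmx_block (1%:M : 'M[R]_1) 0 0 Q a%:M 0 0 (diag_mx d *m Q^T).
by rewrite !(mul0mx, mulmx0, addr0, add0r, mul1mx) => <-.
Qed.

End Psd.

(** * Eigenvalue bounds, complementarity and kernel projections *)

Section PsdConsequences.
Context {R : realType}.

Lemma diag_form n k (d : 'rV[R]_n) (Y : 'M[R]_(n, k)) :
  frob_inner Y (diag_mx d *m Y) = \sum_i \sum_j d 0 i * Y i j ^+ 2.
Proof.
rewrite frob_innerE; apply: eq_bigr => i _; apply: eq_bigr => j _.
by rewrite mul_diag_mx mxE mulrCA expr2.
Qed.

Lemma frob_outer n (A : 'M[R]_n) (v : 'cV[R]_n) :
  frob_inner (v *m v^T) A = frob_inner v (A *m v).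
Proof. by rewrite /frob_inner trmx_mul trmxK -mulmxA mxtrace_mulC mulmxA. Qed.

Lemma psd_spectral n (A : 'M[R]_n) : psdmx A ->
  exists (Q : 'M[R]_n) (d : 'rV[R]_n),
    [/\ Q^T *m Q = 1%:M, Q *m Q^T = 1%:M, A = Q *m diag_mx d *m Q^T
      & forall i, 0 <= d 0 i].
Proof.
move=> /psdmxP[sA pA]; have [Q [d [QQ AE]]] := symmetric_spectral sA.
exists Q, d; split => // [|i]; first exact: mulmx1C.
have := pA (Q *m delta_mx i 0); rewrite frob_inner_mull AE !mulmxA QQ mul1mx.
rewrite -!mulmxA (mulmxA Q^T) QQ mul1mx diag_form (bigD1 i) //= big_ord1 big1.
  by rewrite mxE !eqxx expr1n mulr1 addr0.
by move=> j /negPf ji; rewrite big_ord1 mxE ji expr0n mulr0.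
Qed.

(** Each eigenvalue lies between 0 and the sum of all. The last bound is [A^2 <= tr A * A]; with a
    symmetric [P] for [X] it reads [|A P|^2 <= tr A * tr (P A P)]. *)
Lemma psd_trace_bounds n k (A : 'M[R]_n) (X : 'M[R]_(n, k)) : psdmx A ->
  [/\ 0 <= \tr A, 0 <= frob_inner X (A *m X),
    frob_inner X (A *m X) <= \tr A * frob_inner X X
    & frob_inner (A *m X) (A *m X) <= \tr A * frob_inner X (A *m X)].
Proof.
move=> /psd_spectral[Q [d [QQ QQt -> d0]]].
have trE : \tr (Q *m diag_mx d *m Q^T) = \sum_i d 0 i.
  by rewrite mxtrace_mulC mulmxA QQ mul1mx mxtrace_diag.
have di i : d 0 i <= \sum_i d 0 i.
  by rewrite (bigD1 i) //= lerDl sumr_ge0.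
have inQ (Y Z : 'M[R]_(n, k)) : frob_inner (Q *m Y) (Q *m Z) = frob_inner Y Z.
  by rewrite frob_inner_mull mulmxA QQ mul1mx.
have -> : X = Q *m (Q^T *m X) by rewrite mulmxA QQt mul1mx.
set Y := Q^T *m X.
have -> : Q *m diag_mx d *m Q^T *m (Q *m Y) = Q *m (diag_mx d *m Y).
  by rewrite -!mulmxA (mulmxA Q^T) QQ mul1mx.
rewrite trE !inQ diag_form; split.
- exact: sumr_ge0.
- by do 2![apply: sumr_ge0 => ? _]; rewrite mulr_ge0 ?sqr_ge0.
- rewrite frob_innerE mulr_sumr; apply: ler_sum => i _.
  rewrite mulr_sumr; apply: ler_sum => j _.
  by rewrite -expr2 ler_wpM2r ?sqr_ge0.
- rewrite frob_innerE mulr_sumr; apply: ler_sum => i _.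
  rewrite mulr_sumr; apply: ler_sum => j _.
  rewrite mul_diag_mx mxE -expr2 exprMn expr2 -mulrA ler_wpM2r //.
  by rewrite mulr_ge0 ?sqr_ge0.
Qed.

Lemma psd_trace_ge0 n (A : 'M[R]_n) : psdmx A -> 0 <= \tr A.
Proof. by move=> /(@psd_trace_bounds _ 0 _ 0)[]. Qed.

Lemma psd_trace_eq0 n (A : 'M[R]_n) : psdmx A -> \tr A = 0 -> A = 0.
Proof.
move=> pA A0; have [_ _ _] := @psd_trace_bounds _ _ _ 1%:M pA.
rewrite A0 mul0r mulmx1 => H; apply/eqP; rewrite -frob_inner_eq0 eq_le H.
exact: frob_inner_ge0.
Qed.

Lemma psd_conj n k (A : 'M[R]_n) (X : 'M[R]_(n, k)) :
  psdmx A -> psdmx (X^T *m A *m X).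
Proof.
move=> /psdmxP[sA pA]; apply/psdmxP; split.
  by rewrite !trmx_mul trmxK sA mulmxA.
by move=> v; rewrite -!mulmxA frob_innerC frob_inner_mull trmxK frob_innerC pA.
Qed.

Lemma psd_frob_ge0 n (A B : 'M[R]_n) : psdmx A -> psdmx B ->
  0 <= frob_inner A B.
Proof.
move=> pA /psd_spectral[Q [d [QQ QQt -> d0]]].
have pC := psd_conj Q pA.
rewrite /frob_inner (psdmx_sym pA) mulmxA mxtrace_mulC !mulmxA.
rewrite /mxtrace; apply: sumr_ge0 => i _; rewrite mul_mx_diag mxE mulr_ge0 //.
have := psdmx_form_ge0 (delta_mx i 0) pC.
rewrite frob_innerE (bigD1 i) //= big_ord1 big1 ?addr0 => [|j /negPf ji]; last first.
  by rewrite big_ord1 mxE ji mul0r.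
by rewrite mxE !eqxx mul1r -colE mxE.
Qed.

(* With S the square root of B, tr (S A S) = tr (A B) = 0 forces S A S = 0. *)
Lemma psd_frob_eq0 n (A B : 'M[R]_n) : psdmx A -> psdmx B ->
  frob_inner A B = 0 -> A *m B = 0.
Proof.
move=> pA pB AB0.
have [Q [d [QQ QQt BE d0]]] := psd_spectral pB.
pose S := Q *m diag_mx (map_mx Num.sqrt d) *m Q^T.
have SS : S *m S = B.
  rewrite /S BE -!mulmxA (mulmxA Q^T) QQ mul1mx (mulmxA (diag_mx _)).
  rewrite mulmx_diag; congr (_ *m (diag_mx _ *m _)).
  by apply/rowP => i; rewrite !mxE -expr2 sqr_sqrtr.
have sS : S^T = S by rewrite /S !trmx_mul trmxK tr_diag_mx mulmxA.
have sA := psdmx_sym pA.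
have SAS0 : S *m A *m S = 0.
  rewrite -{1}sS; apply: psd_trace_eq0; first exact: psd_conj.
  rewrite sS -mulmxA mxtrace_mulC -mulmxA SS.
  by rewrite -AB0 /frob_inner sA.
have AS0 : A *m S = 0.
  apply/eqP; rewrite -frob_inner_eq0 eq_le frob_inner_ge0 andbT.
  have [_ _ _] := psd_trace_bounds S pA.
  have -> : frob_inner S (A *m S) = 0.
    by rewrite /frob_inner sS mulmxA SAS0 mxtrace0.
  by rewrite mulr0.
by rewrite -SS mulmxA AS0 mul0mx.
Qed.

(* P is the orthogonal projection onto ker A. As 0^-1 = 0, only the positive
   eigenvalues contribute to s below, so s^-1 bounds them from below. *)
Lemma psd_kernel_projection n (A : 'M[R]_n) : psdmx A ->
  exists (P : 'M[R]_n) (mu : R),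
    [/\ P^T = P, P *m P = P, A *m P = 0, 0 < mu &
      forall v : 'cV[R]_n,
        mu * frob_inner (v - P *m v) (v - P *m v) <= frob_inner v (A *m v)].
Proof.
move=> /psd_spectral[Q [d [QQ QQt AE d0]]].
pose z := \row_i (d 0 i == 0)%:R : 'rV[R]_n.
pose s := 1 + \sum_i (d 0 i)^-1.
have s0 : 0 < s by rewrite ltr_wpDr // sumr_ge0 // => i _; rewrite invr_ge0.
exists (Q *m diag_mx z *m Q^T), s^-1; split.
- by rewrite !trmx_mul trmxK tr_diag_mx mulmxA.
- rewrite -!mulmxA (mulmxA Q^T) QQ mul1mx (mulmxA (diag_mx _)) mulmx_diag.
  congr (_ *m (diag_mx _ *m _)).
  by apply/rowP => i; rewrite !mxE; case: eqP; rewrite ?mulr1 ?mulr0.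
- rewrite AE -!mulmxA (mulmxA Q^T) QQ mul1mx (mulmxA (diag_mx _)) mulmx_diag.
  rewrite (_ : diag_mx _ = 0) ?mul0mx ?mulmx0 //.
  apply/matrixP => i j; rewrite !mxE.
  by case: eqP => [->|_]; rewrite ?mul0r ?mulr0 mul0rn.
- by rewrite invr_gt0.
move=> v; have -> : v = Q *m (Q^T *m v) by rewrite mulmxA QQt mul1mx.
set y := Q^T *m v.
have -> : Q *m diag_mx z *m Q^T *m (Q *m y) = Q *m (diag_mx z *m y).
  by rewrite -!mulmxA (mulmxA Q^T) QQ mul1mx.
have -> : A *m (Q *m y) = Q *m (diag_mx d *m y).
  by rewrite AE -!mulmxA (mulmxA Q^T) QQ mul1mx.
have inQ (u w : 'cV[R]_n) : frob_inner (Q *m u) (Q *m w) = frob_inner u w.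
  by rewrite frob_inner_mull mulmxA QQ mul1mx.
rewrite -mulmxBr !inQ diag_form frob_innerE mulr_sumr; apply: ler_sum => i _.
rewrite !big_ord1 mul_diag_mx !mxE.
have [->|di] := eqVneq (d 0 i) 0; first by rewrite mul1r subrr !mul0r mulr0.
rewrite mul0r subr0 -expr2 ler_wpM2r ?sqr_ge0 //.
rewrite -[leRHS]invrK lef_pV2 ?posrE ?invr_gt0 ?lt_def ?di ?d0 //; last first.
  by rewrite gt_eqF //= ltW.
rewrite /s (bigD1 i) //= addrCA lerDl addr_ge0 // sumr_ge0 // => j _.
by rewrite invr_ge0.
Qed.

Lemma pdmx_psd n (A : 'M[R]_n) : pdmx A -> psdmx A.
Proof.
move=> /pdmxP[sA pA]; apply/psdmxP; split => // v.
by have [->|/pA/ltW//] := eqVneq v 0; rewrite frob_inner0l.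
Qed.

Lemma pd_coercive n (A : 'M[R]_n) : pdmx A ->
  exists2 mu : R, 0 < mu &
    forall v : 'cV[R]_n, mu * frob_inner v v <= frob_inner v (A *m v).
Proof.
move=> pA; have [P [mu [sP PP AP mu0 H]]] := psd_kernel_projection (pdmx_psd pA).
exists mu => // v; have := H v; suff -> : P *m v = 0 by rewrite subr0.
apply/eqP; have [//|Pv0] := eqVneq (P *m v) 0.
have [_ /(_ _ Pv0)] := iffLR (pdmxP _) pA.
by rewrite mulmxA AP mul0mx frob_inner0r ltxx.
Qed.

End PsdConsequences.

(** * The nuclear norm *)

Section Nuclear.
Context {R : realType}.

Lemma char_poly_conj n (Q : 'M[R]_n) (d : 'rV[R]_n) : Q^T *m Q = 1%:M ->
  char_poly (Q *m diag_mx d *m Q^T) = \prod_(i < n) ('X - (d 0 i)%:P).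
Proof.
move=> QQ; have QQt := mulmx1C QQ.
have <- : char_poly (diag_mx d) = \prod_(i < n) ('X - (d 0 i)%:P).
  rewrite char_poly_trig; last by apply/is_trig_mxP => i j /ltn_eqF ij; rewrite mxE -val_eqE ij.
  by apply: eq_bigr => i _; rewrite mxE eqxx.
rewrite /char_poly /char_poly_mx !map_mxM.
set q := map_mx polyC Q; set q' := map_mx polyC Q^T.
have qq : q *m q' = 1%:M by rewrite -map_mxM QQt map_mx1.
have XE : 'X%:M = q *m 'X%:M *m q' by rewrite mul_mx_scalar -scalemxAl qq scalemx1.
by rewrite [in LHS]XE -mulmxBl -mulmxBr !det_mulmx mulrAC -det_mulmx qq det1 mul1r.
Qed.

(** Any orthogonal diagonalization of [X^T X] may replace the roots of its characteristic
    polynomial: the two lists of eigenvalues agree up to order, multiplicities included. *)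
Lemma nuclear_normE m n (X : 'M[R]_(m, n)) (Q : 'M[R]_n) (d : 'rV[R]_n) :
  Q^T *m Q = 1%:M -> X^T *m X = Q *m diag_mx d *m Q^T ->
  nuclear_norm X = \sum_i Num.sqrt (d 0 i).
Proof.
move=> QQ XE; rewrite /nuclear_norm /singular_values XE char_poly_conj //.
pose s := [seq d 0 i | i <- index_enum 'I_n].
have -> : \prod_(i < n) ('X - (d 0 i)%:P) = \prod_(y <- s) ('X - y%:P).
  by rewrite big_map.
have -> : \sum_i Num.sqrt (d 0 i) = \sum_(y <- s) Num.sqrt y by rewrite big_map.
have p0 : \prod_(y <- s) ('X - y%:P) != 0 by rewrite monic_neq0 // monic_prod_XsubC.
have perm_roots : perm_eq (rootsR (\prod_(y <- s) ('X - y%:P))) (undup s).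
  apply: uniq_perm; rewrite ?undup_uniq ?uniq_roots // => x.
  by rewrite -(roots_on_rootsR p0) mem_undup /= root_prod_XsubC.
rewrite big_flatten /= [LHS]big_map (perm_big _ perm_roots) /=.
rewrite -[RHS](perm_big _ (perm_count_undup s)) big_flatten /= [RHS]big_map.
apply: eq_bigr => a _.
by rewrite mu_prod_XsubC !big_nseq.
Qed.

(* X = W V with V = (X^T X)^(1/2); W is a partial isometry with kernel ker V. *)
Lemma polar_decomposition m n (X : 'M[R]_(m, n)) :
  exists (W : 'M[R]_(m, n)) (V G : 'M[R]_n),
    [/\ psdmx V, \tr V = nuclear_norm X, X = W *m V & W^T *m W = G *m V] /\
    (W^T *m W *m V = V /\ W^T *m W *m (W^T *m W) = W^T *m W).
Proof.
have pXX : psdmx (X^T *m X).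
  apply/psdmxP; split; first by rewrite trmx_mul trmxK.
  by move=> v; rewrite -mulmxA frob_innerC frob_inner_mull trmxK frob_inner_ge0.
have [Q [d [QQ QQt XE d0]]] := psd_spectral pXX.
pose F (g : R -> R) := Q *m diag_mx (map_mx g d) *m Q^T.
have FF g h : F g *m F h = F (fun x => g x * h x).
  rewrite /F -!mulmxA (mulmxA Q^T) QQ mul1mx (mulmxA (diag_mx _)) mulmx_diag.
  congr (_ *m (diag_mx _ *m _)); apply/rowP => i; by rewrite !mxE.
have FE g h : (forall x, 0 <= x -> g x = h x) -> F g = F h.
  by move=> gh; rewrite /F; congr (_ *m diag_mx _ *m _); apply/rowP => i; rewrite !mxE gh.
have FT g : (F g)^T = F g by rewrite /F !trmx_mul trmxK tr_diag_mx mulmxA.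
have XXF : X^T *m X = F id by rewrite /F map_mx_id.
(* As [0^-1 = 0], [G] is the Moore-Penrose inverse of [V], and [G V] projects onto the range of
   [V]. *)
pose V := F Num.sqrt; pose G := F (fun x => (Num.sqrt x)^-1); pose W := X *m G.
have WW : W^T *m W = F (fun x => (x != 0)%:R).
  rewrite /W trmx_mul FT mulmxA -(mulmxA G) XXF FF FF; apply: FE => x x0.
  have [->|x_neq0] := eqVneq x 0; first by rewrite mulr0 mul0r.
  rewrite -[X in _ * X * _](sqr_sqrtr x0) expr2 mulrA mulVf ?mul1r ?mulfV //.
    by rewrite sqrtr_eq0 -ltNge lt_def x_neq0.
  by rewrite sqrtr_eq0 -ltNge lt_def x_neq0.
have GV : G *m V = F (fun x => (x != 0)%:R).
  rewrite FF; apply: FE => x x0.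
  have [->|x_neq0] := eqVneq x 0; first by rewrite sqrtr0 mulr0.
  by rewrite mulVf // sqrtr_eq0 -ltNge lt_def x_neq0.
have EV : F (fun x => (x != 0)%:R) *m V = V.
  rewrite FF; apply: FE => x x0.
  by have [->|x_neq0] := eqVneq x 0; rewrite ?sqrtr0 ?mulr0 ?mul1r.
have VE : V *m F (fun x => (x != 0)%:R) = V.
  rewrite FF; apply: FE => x x0.
  by have [->|x_neq0] := eqVneq x 0; rewrite ?sqrtr0 ?mulr0 ?mulr1.
exists W, V, G; rewrite WW; split; last first.
  split => //; rewrite FF; apply: FE => x x0.
  by case: eqP; rewrite ?mulr0 ?mulr1.
split => //.
- apply/psdmxP; split => [|v]; first exact: FT.
  rewrite /V /F.
  have := diag_form (map_mx Num.sqrt d) (Q^T *m v).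
  rewrite frob_inner_mull trmxK !mulmxA => ->.
  by do 2![apply: sumr_ge0 => ? _]; rewrite mxE mulr_ge0 ?sqr_ge0 ?sqrtr_ge0.
- rewrite (nuclear_normE QQ XE) /V /F mxtrace_mulC mulmxA QQ mul1mx mxtrace_diag.
  by apply: eq_bigr => i _; rewrite mxE.
- rewrite /W -mulmxA GV; set E := F _.
  apply/eqP; rewrite -subr_eq0 -frob_inner_eq0.
  have -> : X - X *m E = X *m (1%:M - E) by rewrite mulmxBr mulmx1.
  rewrite frob_inner_mull mulmxA XXF.
  have -> : F id = V *m V by rewrite FF; apply: FE => x x0; rewrite -expr2 sqr_sqrtr.
  by rewrite -mulmxA mulmxBr mulmx1 VE subrr mulmx0 frob_inner0r.
Qed.

Definition nuclear_lmi m n (X : 'M[R]_(m, n)) (U : 'M[R]_m) (V : 'M[R]_n) :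
    'M[R]_(m + n) := block_mx U X X^T V.

(** Positive semidefinite exactly when the operator norm of [W] is at most 1, that is, when [W] lies
    in the unit ball dual to the nuclear norm. *)
Definition nuclear_mult m n (W : 'M[R]_(m, n)) : 'M[R]_(m + n) :=
  nuclear_lmi (- W) 1%:M 1%:M.

Lemma frob_inner_col_mx m n k (u u' : 'M[R]_(m, k)) (w w' : 'M[R]_(n, k)) :
  frob_inner (col_mx u w) (col_mx u' w') = frob_inner u u' + frob_inner w w'.
Proof. by rewrite /frob_inner tr_col_mx mul_row_col mxtraceD. Qed.

Lemma frob_nuclear_mult m n (W X : 'M[R]_(m, n)) U V :
  frob_inner (nuclear_mult W) (nuclear_lmi X U V) =
  \tr U + \tr V - frob_inner W X *+ 2.
Proof.
rewrite /frob_inner /nuclear_mult /nuclear_lmi tr_block_mx !trmx1 trmxK.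
rewrite mulmx_block mxtrace_block !mul1mx !mxtraceD.
have -> : \tr (- W *m X^T) = - frob_inner W X.
  by rewrite mxtrace_mulC -mxtrace_tr trmx_mul trmxK -frob_innerNl.
rewrite -[\tr ((- W)^T *m X)]/(frob_inner (- W) X) frob_innerNl.
by ring.
Qed.

(** A strictly complementary pair of optimal solutions. The primal one factors as [K^T V K] with [K
    = [W^T 1]]. On the common kernel [u = W w] and [w = W^T u], so [V w = 0] and
    [w = W^T W w = G V w = 0]; this is why the polar factor [W] has to vanish on ker V. *)
Lemma nuclear_multiplier m n (X : 'M[R]_(m, n)) :
  exists (W : 'M[R]_(m, n)) (U : 'M[R]_m) (V : 'M[R]_n),
    [/\ psdmx (nuclear_lmi X U V), psdmx (nuclear_mult W),
      \tr U + \tr V = nuclear_norm X *+ 2 /\ frob_inner W X = nuclear_norm X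
      & forall v : 'cV[R]_(m + n), nuclear_lmi X U V *m v = 0 ->
          frob_inner v (nuclear_mult W *m v) = 0 -> v = 0].
Proof.
have [W [V [G [[pV trV XE WWE] [EV EE]]]]] := polar_decomposition X.
pose K : 'M[R]_(n, m + n) := row_mx W^T 1%:M.
have sV := psdmx_sym pV.
have ME : nuclear_lmi X (W *m V *m W^T) V = K^T *m V *m K.
  rewrite /K tr_row_mx trmxK trmx1 mul_col_mx mul_col_row mul1mx !mulmx1.
  by rewrite -XE /nuclear_lmi XE trmx_mul sV.
have pY : psdmx (nuclear_mult W).
  apply/psdmxP; split.
    by rewrite /nuclear_mult /nuclear_lmi tr_block_mx !trmx1 trmxK.
  move=> v; rewrite -[v]vsubmxK; set u := usubmx v; set w := dsubmx v.
  rewrite /nuclear_mult /nuclear_lmi mul_block_col !mul1mx frob_inner_col_mx.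
  rewrite linearN /= !mulNmx.
  set E := W^T *m W in EE *.
  have sE : E^T = E by rewrite /E trmx_mul trmxK.
  have WwE : frob_inner (W *m w) (W *m w) = frob_inner w (E *m w).
    by rewrite frob_inner_mull mulmxA.
  have EwE : frob_inner (E *m w) (E *m w) = frob_inner w (E *m w).
    by rewrite frob_inner_mull mulmxA sE EE.
  (* Completing squares: [|W w| = |E w|] because [E] is an orthogonal projection. *)
  suff -> : frob_inner u (u - W *m w) + frob_inner w (- (W^T *m u) + w) =
    frob_inner (u - W *m w) (u - W *m w) + frob_inner (w - E *m w) (w - E *m w).
    by rewrite addr_ge0 // frob_inner_ge0.
  rewrite !(frob_innerDl, frob_innerDr, frob_innerNl, frob_innerNr).
  rewrite WwE EwE (frob_innerC (E *m w)) (frob_innerC (W *m w)).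
  rewrite -[frob_inner w (W^T *m u)]frob_inner_mull (frob_innerC (W *m w)).
  by ring.
exists W, (W *m V *m W^T), V; split => //.
- by rewrite ME; exact: psd_conj.
- split.
    by rewrite mxtrace_mulC mulmxA EV trV mulr2n.
  by rewrite {1}XE /frob_inner mulmxA EV.
move=> v; rewrite ME => Mv0 Yv0.
have VK0 : V *m (K *m v) = 0.
  apply: psd_kernel => //.
  rewrite frob_inner_mull !mulmxA Mv0 frob_inner0r //.
have := psd_kernel pY Yv0; rewrite /K -[v]vsubmxK in VK0 *.
move: (usubmx v) (dsubmx v) VK0 => u w {Mv0 Yv0 v}.
rewrite mul_row_col mul1mx /nuclear_mult /nuclear_lmi mul_block_col !mul1mx.
rewrite linearN /= !mulNmx => VK0.
rewrite -(col_mx0 _ _ _ _ : col_mx 0 0 = 0 :> 'cV[R]_(m + n)) => /eq_col_mx[].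
move/eqP; rewrite subr_eq0 => /eqP uE /eqP; rewrite addrC subr_eq0 => /eqP wE.
have Vw0 : V *m w = 0.
  move: VK0; rewrite -wE -mulr2n -scaler_nat -scalemxAr => /eqP.
  by rewrite scaler_eq0 pnatr_eq0 => /eqP.
have w0 : w = 0 by rewrite wE uE mulmxA WWE -mulmxA Vw0 mulmx0.
by rewrite uE w0 mulmx0 col_mx0.
Qed.

End Nuclear.

(** * Subdifferentials of convex functions *)

Section Subdiff.
Context {R : realType} {m n : nat}.
Implicit Types (f : 'M[R]_(m, n) -> \bar R) (X Y Z G : 'M[R]_(m, n)).

Lemma nbhs_frobP X (P : set 'M[R]_(m, n)) :
  nbhs X P <-> exists2 e : R, 0 < e & forall Y, frob_norm (Y - X) < e -> P Y.
Proof.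
split=> [/nbhs_normP[e /= e0 H]|[e e0 H]].
  exists e => // Y XY; apply: H; apply: le_lt_trans XY; rewrite distrC.
  by apply: mx_norm_le => [|i j]; [exact: frob_norm_ge0 | exact: entry_le_frob].
(* The added 1 keeps the divisor positive when the matrices have no entries. *)
have s0 : 0 < Num.sqrt (m * n)%:R + 1 :> R by rewrite ltr_wpDl // sqrtr_ge0.
apply: (iffRL (nbhs_normP X P)); exists (e / (Num.sqrt (m * n)%:R + 1)); first exact: divr_gt0.
move=> Y /=; rewrite ltr_pdivlMr // distrC => XY; apply: H; apply: le_lt_trans XY.
apply: le_trans (frob_le_entries (entry_le_mx_norm _)) _.
by rewrite mulrC ler_wpM2l // lerDl.
Qed.

Lemma cvg_frob_inner (T : Type) (F : set_system T) (FF : Filter F)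
    (A B : T -> 'M[R]_(m, n)) (a b : 'M[R]_(m, n)) :
  A x @[x --> F] --> a -> B x @[x --> F] --> b ->
  frob_inner (A x) (B x) @[x --> F] --> frob_inner a b.
Proof.
move=> Aa Bb; rewrite frob_innerE; under eq_cvg do rewrite frob_innerE.
apply: cvg_big => [|i _]; first exact: add_continuous.
apply: cvg_big => [|j _]; first exact: add_continuous.
apply: cvgM.
- apply: (cvg_comp _ (fun M : 'M[R]_(m, n) => M i j) Aa).
  exact: continuous_coord.
- apply: (cvg_comp _ (fun M : 'M[R]_(m, n) => M i j) Bb).
  exact: continuous_coord.
Qed.

(** Only finite end values are constrained: for an end value [+oo] convexity says nothing, and
    extended arithmetic is avoided. *)
Definition convex_efun f := forall X Z (a b t : R), 0 <= t <= 1 ->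
  f X = a%:E -> f Z = b%:E -> (f (X + t *: (Z - X))%R <= (a + t * (b - a))%:E)%E.

(** If the inequality failed at [Z], convexity would keep the difference quotients along the segment
    from [X] to [Z] at or below the negative number [q] arbitrarily close to [X]. *)
Lemma regular_subdiff_convex f X Z G (a b : R) :
  (forall Y, f Y != -oo%E) -> convex_efun f -> f X = a%:E -> f Z = b%:E ->
  regular_subdiff f X G -> a + frob_inner G (Z - X) <= b.
Proof.
move=> fNy cf fX fZ [_]; rewrite limf_einfE => H.
have [ZX|ZX] := eqVneq (Z - X) 0.
  rewrite ZX frob_inner0r addr0.
  by move/eqP: ZX fZ; rewrite subr_eq0 => /eqP ->; rewrite fX => -[->].
rewrite leNgt; apply/negP => b_lt.
have nZX : 0 < frob_norm (Z - X) by rewrite frob_norm_gt0.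
pose q := (b - a - frob_inner G (Z - X)) / frob_norm (Z - X).
have q0 : (q%:E < 0)%E.
  by rewrite lte_fin /q pmulr_llt0 ?invr_gt0 // -addrA -opprD subr_lt0.
have [_ [V VX <-] qV] := ereal_sup_gt (lt_le_trans q0 H).
have /nbhs_frobP[e e0 He] : nbhs X (fun Y => Y != X -> V Y) by exact: VX.
pose t := Num.min 1 (e / (2 * frob_norm (Z - X))).
have t0 : 0 < t by rewrite lt_min ltr01 divr_gt0 // mulr_gt0.
have t1 : t <= 1 by rewrite ge_min lexx.
have tZX : t *: (Z - X) != 0 by rewrite scaler_eq0 negb_or gt_eqF.
have Vt : V (X + t *: (Z - X)).
  apply: He; last by rewrite -subr_eq0 addrAC subrr add0r.
  rewrite addrAC subrr add0r frob_normZ gtr0_norm // -ltr_pdivlMr //.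
  rewrite (@le_lt_trans _ _ (e / (2 * frob_norm (Z - X)))) // ?ge_min ?lexx ?orbT //.
  rewrite invfM mulrA ltr_pM2r ?invr_gt0 // ltr_pdivrMr // ltr_pMr // ltr1n //.
have fle : (f (X + t *: (Z - X))%R <= (a + t * (b - a))%:E)%E.
  by apply: cf => //; rewrite (ltW t0) t1.
case fXt : (f (X + t *: (Z - X))) (fNy (X + t *: (Z - X))) fle => [r| |] //= _.
rewrite lee_fin => rle.
have := lt_le_trans qV (ereal_inf_lbound (imageP _ Vt)).
rewrite fXt fX (_ : X + _ - X = t *: (Z - X)); last by rewrite addrAC subrr add0r.
rewrite frob_normZ gtr0_norm // frob_innerZr.
rewrite inver mulf_eq0 !gt_eqF //= -!EFinB -EFinM lte_fin ltNge => /negP; apply.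
rewrite invfM mulrA ler_pM2r ?invr_gt0 // ler_pdivrMr //.
rewrite [leRHS](_ : _ = t * (b - a) - t * frob_inner G (Z - X)); last by ring.
by rewrite lerB // lerBlDl.
Qed.

Lemma subdiff_convex f X G :
  (forall Y, f Y != -oo%E) -> convex_efun f -> subdiff f X G ->
  exists2 a : R, f X = a%:E &
    forall Z b, f Z = b%:E -> a + frob_inner G (Z - X) <= b.
Proof.
move=> fNy cf [fX [Xs [Gs [XsX fXs GsG sub]]]].
case fXa : (f X) fX (fNy X) => [a| |] //= _ _; exists a => // Z b fZ.
have fin k : f (Xs k) = (fine (f (Xs k)))%:E.
  by have [+ _] := sub k; case: (f (Xs k)) (fNy (Xs k)).
have H k : fine (f (Xs k)) + frob_inner (Gs k) (Z - Xs k) <= b.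
  exact: (regular_subdiff_convex fNy cf (fin k) fZ (sub k)).
rewrite fXa in fXs.
apply: (@cvgr_to_le _ (nbhs \oo) _ _
  (fun k => fine (f (Xs k)) + frob_inner (Gs k) (Z - Xs k))); last exact: nearW.
apply: cvgD; first exact: (fine_cvg fXs).
by apply: cvg_frob_inner => //; apply: cvgB => //; exact: cvg_cst.
Qed.

Lemma convex_subdiff f X G (a : R) : f X = a%:E ->
  (forall Z, (a + frob_inner G (Z - X))%:E <= f Z)%E -> subdiff f X G.
Proof.
move=> fX H; split; first by rewrite fX ltry.
exists (fun=> X), (fun=> G); split=> [|||_]; try exact: cvg_cst.
split; first by rewrite fX ltry.
rewrite limf_einfE; apply: le_trans (ereal_sup_ubound _); last first.
  exists (fun Y => Y != X); last reflexivity.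
  by apply/nbhs_frobP; exists 1.
apply: le_ereal_inf_tmp => _ [Y YX <-]; rewrite fX.
have nYX : 0 < frob_norm (Y - X) by rewrite frob_norm_gt0 subr_eq0.
apply: mule_ge0; last by rewrite inve_ge0 lee_fin ltW.
have := H Y; case: (f Y) => [r| |] //=.
  by rewrite -!EFinB !lee_fin => h; rewrite subr_ge0 lerBrDl.
by rewrite !addye // leey.
Qed.

Lemma relint_opp (C : set 'M[R]_(m, n)) G : relint C 0 -> C G ->
  exists2 t : R, 0 < t & C (- t *: G).
Proof.
move=> [C0 /nbhs_frobP[e e0 He]] CG; have [G0|G0] := eqVneq G 0.
  by exists 1; rewrite // G0 scaler0.
have nG : 0 < frob_norm G by rewrite frob_norm_gt0.
exists (e / (2 * frob_norm G)); first by rewrite divr_gt0 // mulr_gt0.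
set t := e / _; have t0 : 0 < t by rewrite divr_gt0 // mulr_gt0.
apply: He.
  rewrite subr0 frob_normZ normrN gtr0_norm // -ltr_pdivlMr //.
  by rewrite /t invfM mulrA ltr_pM2r ?invr_gt0 // ltr_pdivrMr // ltr_pMr // ltr1n.
(* [- t *: G] is the affine combination of 0 and [G] with weights [1 + t] and [- t]. *)
exists 2, (fun i => if i == 0 then 1 + t else - t), (fun i => if i == 0 then 0 else G).
split=> [i||]; first by case: ifP.
- by rewrite !big_ord_recl big_ord0 /= addr0 addrK.
- by rewrite !big_ord_recl big_ord0 /= addr0 scaler0 add0r.
Qed.

End Subdiff.

(** * Projections of spectrahedra *)

Section ConicKL.
Context {R : realType}.

Lemma le0_of_small (x y : R) : (forall t, 0 < t -> x <= t * y) -> x <= 0.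
Proof.
move=> H; rewrite leNgt; apply/negP => x0.
have y0 : 0 < y by apply: lt_le_trans x0 _; rewrite -[y]mul1r; exact: H.
have := H (x / (2 * y)) (divr_gt0 x0 (mulr_gt0 (ltr0n _ 2) y0)).
rewrite leNgt => /negP; apply; rewrite invfM mulrA mulfVK ?gt_eqF //.
by rewrite ltr_pdivrMr // ltr_pMr // ltr1n.
Qed.

(* With a = P v and b = v - P v, the cross term 2 beta |a| |b| is absorbed by
   delta |a|^2 and (beta^2 / delta) |b|^2. *)
Lemma feasible_direction n (L S : 'M[R]_n) (delta : R) : psdmx L -> S^T = S ->
  0 < delta ->
  (forall v : 'cV[R]_n, L *m v = 0 ->
    delta * frob_inner v v <= frob_inner v (S *m v)) ->
  exists2 h : R, 0 < h & psdmx (L + h *: S).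
Proof.
move=> pL sS d0 H.
have [P [mu [sP PP LP mu0 Lmu]]] := psd_kernel_projection pL.
have [beta beta0 Sbeta] := @frob_norm_linear _ _ 1 _ _ (mulmx S).
(* With this step the loss caused by [S] is at most [mu |b|^2], which [L] provides; the 1 keeps the
   divisor positive. *)
pose h := mu / (beta + beta ^+ 2 / delta + 1).
have D0 : 0 < beta + beta ^+ 2 / delta + 1.
  by rewrite ltr_wpDl // addr_ge0 // divr_ge0 ?sqr_ge0 // ltW.
have h0 : 0 < h by rewrite divr_gt0.
exists h => //; apply/psdmxP; split; first by rewrite linearD linearZ /= (psdmx_sym pL) sS.
move=> v; rewrite mulmxDl -scalemxAl frob_innerDr frob_innerZr.
pose a := P *m v; pose b := v - a.
have Ha : delta * frob_norm a ^+ 2 <= frob_inner a (S *m a).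
  by rewrite frob_norm_sqr; apply: H; rewrite /a mulmxA LP mul0mx.
have Hab : - (beta * frob_norm a * frob_norm b) <= frob_inner a (S *m b).
  rewrite lerNl -frob_innerNl; apply: le_trans (frob_cauchy_schwarz _ _) _.
  by rewrite frob_normN [beta * _]mulrC -mulrA ler_wpM2l ?frob_norm_ge0 // Sbeta.
have Hbb : - (beta * frob_norm b ^+ 2) <= frob_inner b (S *m b).
  rewrite lerNl -frob_innerNl; apply: le_trans (frob_cauchy_schwarz _ _) _.
  by rewrite frob_normN expr2 mulrCA ler_wpM2l ?frob_norm_ge0 // Sbeta.
have HL : mu * frob_norm b ^+ 2 <= frob_inner v (L *m v).
  by rewrite frob_norm_sqr; exact: Lmu.
have Sv : frob_inner v (S *m v) = frob_inner a (S *m a) +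
    frob_inner a (S *m b) *+ 2 + frob_inner b (S *m b).
  have Sba : frob_inner b (S *m a) = frob_inner a (S *m b).
    by rewrite -{1}sS -frob_inner_mull frob_innerC.
  have -> : v = a + b by rewrite /b addrC subrK.
  clearbody b; clearbody a.
  by rewrite mulmxDr !(frob_innerDl, frob_innerDr) Sba; ring.
rewrite Sv; move: (frob_inner a _) (frob_inner a _) (frob_inner b _) (frob_inner v _)
  Ha Hab Hbb HL => sab saa sbb sv Ha Hab Hbb HL.
set x := frob_norm a in Ha Hab; set y := frob_norm b in Hab Hbb HL.
have cross : beta * x * y *+ 2 <= delta * x ^+ 2 + beta ^+ 2 / delta * y ^+ 2.
  rewrite -subr_ge0; have -> : delta * x ^+ 2 + beta ^+ 2 / delta * y ^+ 2 -
    beta * x * y *+ 2 = (delta * x - beta * y) ^+ 2 / delta.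
    by field; rewrite gt_eqF.
  by rewrite divr_ge0 ?sqr_ge0 // ltW.
have low : - ((beta + beta ^+ 2 / delta + 1) * y ^+ 2) <= saa + sab *+ 2 + sbb.
  have y2 := sqr_ge0 y; move: (beta ^+ 2 / delta) cross => g cross.
  by lra.
have := ler_wpM2l (ltW h0) low.
have -> : h * - ((beta + beta ^+ 2 / delta + 1) * y ^+ 2) = - (mu * y ^+ 2).
  by rewrite mulrN mulrA /h divfK ?gt_eqF.
by move: HL; lra.
Qed.

(** A linear choice of preimages. Combined with [frob_norm_linear] it corrects a point at a cost
    proportional to the residual, without a norm on the lift space. *)
Lemma linear_pinv (V W : vectType R) (f : {linear V -> W}) :
  exists g : {linear W -> V}, forall w, f (g (f w)) = f w.
Proof.
exists (fun_of_lfun (linfun f)^-1%VF) => w.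
have H : f w \in limg (linfun f) by rewrite -[f w]lfunE memv_img // memvf.
by have := limg_lfunVK H; rewrite lfunE.
Qed.

End ConicKL.

(* f is the projection along pi of the linear function c over the spectrahedron
   L + B w >= 0; w is the displacement from a lift of the reference point Xb. *)
Section Spectrahedral.
Context {R : realType} {m n D : nat} {Z : vectType R}.
Variables (f : 'M[R]_(m, n) -> \bar R) (Xb : 'M[R]_(m, n)) (fb : R).
Variables (L : 'M[R]_D) (B : {linear Z -> 'M[R]_D}).
Variables (pi : {linear Z -> 'M[R]_(m, n)}) (c : {scalar Z}).
Hypothesis psdL : psdmx L.
Hypothesis symB : forall w, (B w)^T = B w.
Hypothesis fNy : forall X, f X != -oo%E.
Hypothesis fXb : f Xb = fb%:E.
Hypothesis f_le : forall w, psdmx (L + B w) -> (f (Xb + pi w)%R <= (fb + c w)%:E)%E.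

Definition subgrad (G : 'M[R]_(m, n)) :=
  forall X, ((fb + frob_inner G (X - Xb)%R)%:E <= f X)%E.

Section Multiplier.
Variable sigma : Z.
Hypothesis slater : pdmx (L + B sigma).

(** Under the Slater condition this is the closure of the cone of feasible directions at [w = 0];
    its members need not be feasible themselves. *)
Definition tangent w := forall v : 'cV[R]_D, L *m v = 0 -> 0 <= frob_inner v (B w *m v).

Lemma subgrad_tangent G w : subgrad G -> tangent w -> frob_inner G (pi w) <= c w.
Proof.
move=> sG Kw; have [mu mu0 coer] := pd_coercive slater.
rewrite -subr_le0; apply: (@le0_of_small _ _ (c sigma - frob_inner G (pi sigma))) => t t0.
pose e := w + t *: sigma.
(* On ker L the forms of [B sigma] and [L + B sigma] agree, so [e] has modulus [t * mu] there. *)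
have [|h h0 psdh] := feasible_direction psdL (symB e) (mulr_gt0 t0 mu0).
  move=> v Lv; rewrite /e linearD linearZ /= mulmxDl -scalemxAl frob_innerDr frob_innerZr.
  apply: ler_wpDl; first exact: Kw.
  rewrite -mulrA ler_wpM2l ?(ltW t0) //; apply: le_trans (coer v) _.
  by rewrite mulmxDl Lv add0r.
rewrite -linearZ in psdh; have := le_trans (sG _) (f_le psdh).
rewrite lee_fin addrAC subrr add0r lerD2l !linearZ /= ler_pM2l //.
rewrite /e !(linearD, linearZ) /=; lra.
Qed.

Variables (Y0 : 'M[R]_D) (G0 : 'M[R]_(m, n)).
Hypothesis lift : forall X a, f X = a%:E ->
  exists w, [/\ X = Xb + pi w, psdmx (L + B w) & c w = a - fb].
Hypothesis sub0 : subgrad 0.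
Hypothesis sub_opp : forall G, subgrad G -> exists2 t : R, 0 < t & subgrad (- t *: G).
Hypothesis psdY0 : psdmx Y0.
Hypothesis Y0L : frob_inner Y0 L = 0.
Hypothesis Y0_pos : forall v : 'cV[R]_D, L *m v = 0 -> frob_inner v (Y0 *m v) = 0 -> v = 0.
Hypothesis trace_bound : exists2 C : R, 0 <= C & forall w, psdmx (L + B w) -> 0 <= c w ->
  \tr (L + B w) <= C * (1 + c w + frob_norm (pi w)).
Hypothesis Y0_lagrange : forall w, c w - frob_inner Y0 (B w) = frob_inner G0 (pi w).

(** Weak duality: [c w - <G0, pi w> = <Y0, B w> = <Y0, L + B w> >= 0] at a feasible lift. *)
Lemma subgrad_multiplier : subgrad G0.
Proof.
move=> X; case fX : (f X) (fNy X) => [a| |] // _; last by rewrite leey.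
have [w [-> psdw cw]] := lift fX.
rewrite lee_fin addrAC subrr add0r -Y0_lagrange cw.
have := psd_frob_ge0 psdY0 psdw; rewrite frob_innerDr Y0L add0r; lra.
Qed.

Variables (P : 'M[R]_D) (mu : R).
Hypotheses (sP : P^T = P) (LP : L *m P = 0) (mu_gt0 : 0 < mu).
Hypothesis L_coercive : forall v : 'cV[R]_D,
  mu * frob_inner (v - P *m v) (v - P *m v) <= frob_inner v (L *m v).

Lemma kernel_proj k (V : 'M[R]_(D, k)) : L *m V = 0 -> P *m V = V.
Proof.
move=> LV; suff H (v : 'cV[R]_D) : L *m v = 0 -> P *m v = v.
  apply/matrixP => i j; have := H (V *m delta_mx j 0).
  rewrite !mulmxA LV mul0mx -!colE => /(_ erefl) /matrixP/(_ i 0).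
  by rewrite ![col _ _ _ _]mxE.
move=> Lv; have := L_coercive v; rewrite Lv frob_inner0r.
rewrite pmulr_rle0 // => H; apply/esym/eqP.
by rewrite -subr_eq0 -frob_inner_eq0 eq_le H frob_inner_ge0.
Qed.

Definition compress w : 'M[R]_D := P *m B w *m P.

Lemma compress_is_linear : linear compress.
Proof.
move=> a u v; rewrite /compress linearP /= mulmxDr mulmxDl.
by rewrite -scalemxAr -scalemxAl.
Qed.

HB.instance Definition _ := GRing.isLinear.Build R Z 'M[R]_D *:%R compress
  compress_is_linear.

Lemma compress_form w (v : 'cV[R]_D) :
  frob_inner v (compress w *m v) = frob_inner (P *m v) (B w *m (P *m v)).
Proof. by rewrite frob_inner_mull sP /compress -!mulmxA. Qed.

Lemma compress_sym w : (compress w)^T = compress w.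
Proof. by rewrite /compress !trmx_mul sP symB mulmxA. Qed.

Lemma tangentP w : tangent w <-> psdmx (compress w).
Proof.
split=> [Kw|/psdmxP[_ pw] v Lv].
  apply/psdmxP; split=> [|v]; first exact: compress_sym.
  by rewrite compress_form; apply: Kw; rewrite mulmxA LP mul0mx.
by have := pw v; rewrite compress_form kernel_proj.
Qed.

Lemma tangent_ge0 w : tangent w -> 0 <= c w.
Proof. by move=> /(subgrad_tangent sub0); rewrite frob_inner0l. Qed.

(** Both [w] and [- w] are tangent. Hence [c] factors through [compress], and growth can be studied
    on compressed matrices. *)
Lemma compress0_c w : compress w = 0 -> c w = 0.
Proof.
move=> w0; apply/eqP; rewrite eq_le; apply/andP; split.
  rewrite -oppr_ge0 -linearN; apply: tangent_ge0; apply/tangentP.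
  rewrite linearN /= w0 oppr0; apply/psdmxP; split; first exact: trmx0.
  by move=> v; rewrite mul0mx frob_inner0r.
apply: tangent_ge0; apply/tangentP; rewrite w0.
apply/psdmxP; split; first exact: trmx0.
by move=> v; rewrite mul0mx frob_inner0r.
Qed.

(* Strict complementarity: sub_opp forces c w = <G0, pi w> = 0, so Y0, which is
   definite on ker L, annihilates the compression of B w to ker L. *)
Lemma tangent_strict w : tangent w -> c w <= 0 -> compress w = 0.
Proof.
move=> Kw cw_le; have cw0 : c w = 0 by apply/eqP; rewrite eq_le cw_le tangent_ge0.
have G0w : frob_inner G0 (pi w) = 0.
  apply/eqP; rewrite eq_le; apply/andP; split.
    by rewrite -cw0; exact: subgrad_tangent subgrad_multiplier Kw.
  have [t t0 /subgrad_tangent /(_ Kw)] := sub_opp subgrad_multiplier.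
  by rewrite frob_innerZl cw0 mulNr oppr_le0 pmulr_rge0.
have Y0B : frob_inner Y0 (B w) = 0.
  by have := Y0_lagrange w; rewrite cw0 G0w sub0r => /eqP; rewrite oppr_eq0 => /eqP.
have sY0 := psdmx_sym psdY0; have sL := psdmx_sym psdL.
(* Complementarity [Y0 L = 0] places the range of [Y0] in ker L. *)
have PY0 : P *m Y0 = Y0.
  apply: kernel_proj; rewrite -[LHS]trmxK trmx_mul sY0 sL.
  by rewrite (psd_frob_eq0 psdY0 psdL Y0L) trmx0.
have Y0P : Y0 *m P = Y0 by rewrite -{1}sY0 -sP -trmx_mul PY0 sY0.
have Y0w : Y0 *m compress w = 0.
  apply: (psd_frob_eq0 psdY0); first exact/tangentP.
  rewrite -Y0B -{2}Y0P -{2}PY0 /frob_inner /compress !trmx_mul sP sY0.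
  rewrite !mulmxA Y0P PY0 mxtrace_mulC !mulmxA PY0 Y0P //.
have cw_col (v : 'cV[R]_D) : compress w *m v = 0.
  apply: Y0_pos.
    by rewrite /compress !mulmxA LP !mul0mx.
  by rewrite mulmxA Y0w mul0mx frob_inner0r.
apply/matrixP => i j; have /matrixP/(_ i 0) := cw_col (delta_mx j 0).
by rewrite -colE !mxE.
Qed.

(** Directions with zero compression make the set of [w] unbounded, so the minimum is taken over the
    compact set [A] of trace-one positive semidefinite matrices in the image of [compress], with [g]
    choosing preimages. The minimum is positive by [tangent_strict]. *)
Lemma tangent_growth :
  exists2 lambda : R, 0 < lambda & forall w, tangent w -> lambda * \tr (compress w) <= c w.
Proof.
have [g gK] := linear_pinv compress.
have c_g w : c (g (compress w)) = c w.
  by apply/eqP; rewrite -subr_eq0 -linearB compress0_c // linearB /= gK subrr.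
pose A : set 'rV[R]_(D * D) := [set s | (forall v : 'cV[R]_D,
    0 <= frob_inner (v *m v^T) (vec_mx s)) /\
  frob_inner 1%:M (vec_mx s) = 1 /\
  forall M, frob_inner M (compress (g (vec_mx s))) - frob_inner M (vec_mx s) = 0].
have AP s : A s -> [/\ tangent (g (vec_mx s)), compress (g (vec_mx s)) = vec_mx s
    & \tr (vec_mx s) = 1].
  move=> [s_ge0 [s_tr s_im]].
  have im : compress (g (vec_mx s)) = vec_mx s.
    apply/eqP; rewrite -subr_eq0 -frob_inner_eq0.
    by rewrite frob_innerDr frob_innerNr s_im.
  split => //; last by rewrite -s_tr /frob_inner trmx1 mul1mx.
  apply/tangentP; rewrite im; apply/psdmxP; split; first by rewrite -im compress_sym.
  by move=> v; rewrite -frob_outer.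
have linear_cont (l : {scalar 'rV[R]_(D * D)}) : continuous l.
  exact: linear_mx_continuous.
have inner_cont M : continuous (fun s : 'rV[R]_(D * D) => frob_inner M (vec_mx s)).
  exact: (linear_cont (frob_inner M \o vec_mx)).
have compactA : compact A.
  apply: bounded_closed_compact.
    exists 1; split => // N N1 s /AP[Ks im tr1].
    have psdS : psdmx (vec_mx s) by rewrite -im; apply/tangentP.
    have nS : frob_norm (vec_mx s) <= 1.
      rewrite -(ler_pXn2r (n:=2)) ?nnegrE ?frob_norm_ge0 // frob_norm_sqr expr1n.
      have [_ _ H1 H2] := psd_trace_bounds 1%:M psdS.
      rewrite mulmx1 tr1 mul1r in H2; apply: le_trans H2 _.
      by rewrite /frob_inner trmx1 mul1mx tr1.
    apply: ltW; apply: le_lt_trans N1; apply: mx_norm_le => // i k.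
    rewrite (ord1 i); apply: le_trans nS; case/mxvec_indexP: k => i' j'.
    have := entry_le_frob (vec_mx s) i' j'; rewrite mxE.
    by [].
  have -> : A = [set s | forall v : 'cV[R]_D, 0 <= frob_inner (v *m v^T) (vec_mx s)]
     `&` ([set s | frob_inner 1%:M (vec_mx s) = 1] `&` [set s | forall M,
      frob_inner M (compress (g (vec_mx s))) - frob_inner M (vec_mx s) = 0]) by [].
  apply: closedI.
    rewrite (_ : [set _ | _] = \bigcap_(v in [set: 'cV[R]_D])
      [set s | 0 <= frob_inner (v *m v^T) (vec_mx s)]); last first.
      by apply/seteqP; split => [s H v _|s H v]; exact: H.
    by apply: closed_bigI => v _; apply: closed_fun_ge; exact: inner_cont.
  apply: closedI; first by apply: closed_fun_eq; exact: inner_cont.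
  rewrite (_ : [set _ | _] = \bigcap_(M in [set: 'M[R]_D]) [set s |
    frob_inner M (compress (g (vec_mx s))) - frob_inner M (vec_mx s) = 0]); last first.
    by apply/seteqP; split => [s H v _|s H v]; exact: H.
  apply: closed_bigI => M _; apply: closed_fun_eq.
  exact: (linear_cont ((frob_inner M \o (compress \o (g \o vec_mx))) \-
    (frob_inner M \o vec_mx))).
have scaled w : tangent w -> 0 < \tr (compress w) ->
    A (mxvec ((\tr (compress w))^-1 *: compress w)).
  move=> Kw tr0; rewrite /A /= mxvecK; split=> [v|].
    rewrite frob_innerZr mulr_ge0 // ?invr_ge0 ?(ltW tr0) // frob_outer.
    by apply: psdmx_form_ge0; apply/tangentP.
  split; first by rewrite /frob_inner trmx1 mul1mx mxtraceZ mulVf // gt_eqF.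
  move=> M; rewrite [g _]linearZ /= [compress (_ *: _)]linearZ /= gK.
  by rewrite subrr.
have tr_ge0 w : tangent w -> 0 <= \tr (compress w).
  by move=> /tangentP; exact: psd_trace_ge0.
(* If [A] is empty, every tangent compression has trace 0 and any rate works. *)
have [A0|A0] := pselect (A !=set0); last first.
  exists 1 => // w Kw; rewrite mul1r.
  suff -> : \tr (compress w) = 0 by exact: tangent_ge0.
  apply/eqP; rewrite eq_le tr_ge0 // andbT leNgt; apply/negP => tr0.
  by apply: A0; exists (mxvec ((\tr (compress w))^-1 *: compress w)); exact: scaled.
have [s] := EVT_min_rV A0 compactA
  (continuous_subspaceT (linear_cont (c \o (g \o vec_mx)))).
rewrite inE => /AP[Ks im tr1] s_min; exists (c (g (vec_mx s))).
  rewrite lt_def tangent_ge0 // andbT; apply/negP => /eqP c0.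
  have := tangent_strict Ks; rewrite c0 im => /(_ (lexx _)) s0.
  by move/eqP: tr1; rewrite s0 mxtrace0 eq_sym oner_eq0.
move=> w Kw; have := tr_ge0 w Kw; rewrite le_eqVlt => /orP[/eqP <-|tr0].
  by rewrite mulr0 tangent_ge0.
have := s_min _ (mem_set (scaled w Kw tr0)).
by rewrite /= mxvecK !linearZ /= c_g ler_pdivlMl // mulrC.
Qed.

(** For [S = L + B w] one has [B w P = S P], since [L P = 0]. In [|S P|^2 <= tr S * tr (P S P)] the
    first factor is at most [3 C], as [1 + c w + |pi w| <= 3], and the second at most
    [c w / lambda]. *)
Lemma kernel_part_bound : exists2 kappa : R, 0 <= kappa & forall w,
  psdmx (L + B w) -> 0 <= c w <= 1 -> frob_norm (pi w) <= 1 ->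
  frob_norm (B w *m P) <= kappa * Num.sqrt (c w).
Proof.
have [lambda lambda0 growth] := tangent_growth; have [C C0 trC] := trace_bound.
exists (Num.sqrt (C * 3 / lambda)); first exact: sqrtr_ge0.
move=> w psdw /andP[cw0 cw1] piw1.
have BP : B w *m P = (L + B w) *m P by rewrite mulmxDl LP add0r.
have cE : compress w = P *m (L + B w) *m P.
  by rewrite /compress -mulmxA BP mulmxA.
have Kw : tangent w by apply/tangentP; rewrite cE -{1}sP; exact: psd_conj.
rewrite -sqrtrM ?divr_ge0 ?mulr_ge0 // ?(ltW lambda0) //.
rewrite ler_sqrt ?mulr_ge0 ?divr_ge0 ?mulr_ge0 ?invr_ge0 // ?(ltW lambda0) //.
have [_ _ _] := psd_trace_bounds P psdw; rewrite -BP => /le_trans; apply.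
have -> : frob_inner P (B w *m P) = \tr (compress w).
  by rewrite /frob_inner sP mulmxA.
have tr3 : \tr (L + B w) <= C * 3.
  apply: le_trans (trC _ psdw cw0) _; apply: ler_wpM2l => //; lra.
rewrite -[_ / lambda * _]mulrA; apply: ler_pM => //; first exact: psd_trace_ge0.
  by apply: psd_trace_ge0; apply/tangentP.
by rewrite ler_pdivlMl // growth.
Qed.

(* Moving w along a right inverse of w |-> B w P kills the kernel part at cost
   O(sqrt (c w)); shrinking slightly towards the reference point restores
   feasibility. *)
Lemma minimizer_error_bound : exists2 kappa : R, 0 < kappa & forall w,
  psdmx (L + B w) -> 0 <= c w <= 1 -> frob_norm (pi w) <= 1 ->
  exists w', [/\ psdmx (L + B w'), c w' = 0 &
    frob_norm (pi w - pi w') <= kappa * Num.sqrt (c w)].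
Proof.
have [k0 k00 kerb] := kernel_part_bound.
pose T : {linear Z -> 'M[R]_D} := mulmxr P \o B.
have [g gK] := linear_pinv T.
have [kB kB0 gB] := frob_norm_linear (B \o g).
have [kp kp0 gp] := frob_norm_linear (pi \o g).
exists (kB * k0 / mu + kp * k0 + 1).
  by rewrite ltr_wpDl // addr_ge0 ?divr_ge0 ?mulr_ge0 // ltW.
move=> w psdw cw01 piw1; set s := Num.sqrt (c w).
have s0 : 0 <= s := sqrtr_ge0 _.
have sL := psdmx_sym psdL.
have nT : frob_norm (T w) <= k0 * s := kerb w psdw cw01 piw1.
pose w1 := g (T w); pose w2 := w - w1.
have B2P : B w2 *m P = 0.
  by rewrite -[LHS]/(T w2) linearB gK subrr.
have PB2 : P *m B w2 = 0 by rewrite -sP -(symB w2) -trmx_mul B2P trmx0.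
have PL : P *m L = 0 by rewrite -sP -sL -trmx_mul LP trmx0.
have c2 : c w2 = 0 by apply: compress0_c; rewrite /compress PB2 mul0mx.
have nB1 : frob_norm (B w1) <= kB * (k0 * s).
  by apply: le_trans (gB (T w)) _; exact: ler_wpM2l.
have np1 : frob_norm (pi w1) <= kp * (k0 * s).
  by apply: le_trans (gp (T w)) _; exact: ler_wpM2l.
(* Chosen so that [|B w1| <= r * mu]: after multiplication by [1 + r] there are [r] spare copies of
   [L], which absorb the removal of [B w1]. *)
have [r rE] : exists r, r = kB * (k0 * s) / mu by exists (kB * (k0 * s) / mu).
have r0 : 0 <= r by rewrite rE divr_ge0 ?mulr_ge0 // ltW.
have r1 : 0 < 1 + r by rewrite ltr_wpDr.
exists ((1 + r)^-1 *: w2); split.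
- apply/psdmxP; split; first by rewrite linearD /= sL symB.
  (* Both [L] and [B w2] vanish on the range of [P], so only the component [b], where [L] is
     coercive, enters the form. *)
  move=> v; have [b bE] : exists b, b = v - P *m v by exists (v - P *m v).
  have Lvb : frob_inner v (L *m v) = frob_inner b (L *m b).
    rewrite bE mulmxBr mulmxA LP mul0mx subr0 frob_innerDl frob_innerNl.
    by rewrite frob_inner_mull sP mulmxA PL mul0mx frob_inner0r subr0.
  have Bvb : frob_inner v (B w2 *m v) = frob_inner b (B w2 *m b).
    rewrite bE mulmxBr mulmxA B2P mul0mx subr0 frob_innerDl frob_innerNl.
    by rewrite frob_inner_mull sP mulmxA PB2 mul0mx frob_inner0r subr0.
  have Lb : mu * frob_inner b b <= frob_inner b (L *m b) by rewrite -Lvb bE.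
  have Sb : - (r * mu * frob_inner b b) <= frob_inner b ((L + B w2) *m b).
    have -> : L + B w2 = (L + B w) - B w1 by rewrite /w2 linearB addrA.
    rewrite mulmxBl frob_innerDr frob_innerNr.
    apply: ler_wpDl; first exact: psdmx_form_ge0.
    rewrite lerN2; apply: le_trans (frob_cauchy_schwarz _ _) _.
    rewrite rE divfK ?gt_eqF // -frob_norm_sqr expr2 mulrCA ler_wpM2l ?frob_norm_ge0 //.
    by apply: le_trans (frob_norm_mulmx _ _) _; rewrite ler_wpM2r ?frob_norm_ge0.
  rewrite linearZ /= mulmxDl -scalemxAl frob_innerDr frob_innerZr.
  rewrite -(pmulr_rge0 _ r1) mulrDr mulrA mulfV ?gt_eqF // mul1r Lvb Bvb.
  rewrite mulmxDl frob_innerDr in Sb.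
  have := ler_wpM2l r0 Lb; lra.
- by rewrite linearZ /= c2 mulr0.
rewrite linearZ /= /w2 linearB /=.
have -> : pi w - (1 + r)^-1 *: (pi w - pi w1) =
    (r / (1 + r)) *: pi w + (1 + r)^-1 *: pi w1.
  rewrite scalerBr opprB addrCA addrC; congr (_ + _).
  rewrite -{1}[pi w]scale1r -scalerBl; congr (_ *: _); field.
  by rewrite gt_eqF.
apply: le_trans (frob_normD _ _) _; rewrite !frob_normZ.
rewrite !ger0_norm ?divr_ge0 ?invr_ge0 ?(ltW r1) //.
have H1 : r / (1 + r) * frob_norm (pi w) <= r.
  rewrite -[leRHS]mulr1; apply: ler_pM; rewrite ?frob_norm_ge0 ?divr_ge0 ?(ltW r1) //.
  by rewrite ler_pdivrMr // ler_peMr // lerDl.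
have H2 : (1 + r)^-1 * frob_norm (pi w1) <= kp * (k0 * s).
  rewrite -[leRHS]mul1r; apply: ler_pM; rewrite ?frob_norm_ge0 ?invr_ge0 ?(ltW r1) //.
  by rewrite invf_le1 // lerDl.
apply: le_trans (lerD H1 H2) _.
have -> : r = kB * k0 / mu * s by rewrite rE; ring.
by rewrite !mulrDl mul1r mulrA lerDl.
Qed.

(** * Convexity, the subdifferential and the KL inequality *)

Lemma convex_fun : convex_efun f.
Proof.
move=> X X' a a' t /andP[t0 t1] fX fX'.
have [w [-> psdw cw]] := lift fX; have [w' [-> psdw' cw']] := lift fX'.
have -> : Xb + pi w + t *: (Xb + pi w' - (Xb + pi w)) = Xb + pi (w + t *: (w' - w)).
  have -> : pi (w + t *: (w' - w)) = pi w + t *: (pi w' - pi w).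
    by rewrite linearD linearZ linearB.
  by apply/matrixP => i j; rewrite !mxE; ring.
have <- : fb + c (w + t *: (w' - w)) = a + t * (a' - a).
  by rewrite linearD linearZ linearB /= cw cw'; ring.
apply: f_le.
have -> : L + B (w + t *: (w' - w)) = (1 - t) *: (L + B w) + t *: (L + B w').
  have -> : B (w + t *: (w' - w)) = B w + t *: (B w' - B w).
    by rewrite linearD linearZ linearB.
  by apply/matrixP => i j; rewrite !mxE; ring.
apply/psdmxP; split.
  have sS u : (L + B u)^T = L + B u by rewrite linearD /= symB (psdmx_sym psdL).
  by rewrite [LHS]linearD /= [((1 - t) *: _)^T]linearZ [(t *: _)^T]linearZ /= !sS.
move=> v; rewrite mulmxDl -!scalemxAl frob_innerDr !frob_innerZr.
by rewrite addr_ge0 // mulr_ge0 ?subr_ge0 // psdmx_form_ge0.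
Qed.

Lemma subdiffE G : subdiff f Xb G <-> subgrad G.
Proof.
split=> [/(subdiff_convex fNy convex_fun)[a]|sG]; last exact: convex_subdiff sG.
rewrite fXb => -[<-] H X; case fX : (f X) (fNy X) => [b| |] // _.
  by rewrite lee_fin; exact: H.
by rewrite leey.
Qed.

Lemma KL_half_of_multiplier : lower_semicontinuous f -> KL_property f Xb 2^-1.
Proof.
move=> f_lsc; split=> //; first by split=> //; exists Xb; rewrite fXb ltry.
- by exists 0; apply/subdiffE.
- by lra.
have [kappa k0 errb] := minimizer_error_bound.
(* The value window 1 and the radius 1 below give [c w <= 1] and [|pi w| <= 1]. With [2 * kappa] the
   derivative of [phi] at [e] is [kappa / sqrt e], the inverse of the lower bound for the
   distance. *)
exists 1%:E, (2 * kappa); split; [by rewrite lte_fin | by rewrite mulr_gt0 |].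
move=> phi; apply/nbhs_frobP; exists 1 => // X XXb.
rewrite fXb; case fX : (f X) (fNy X) => [a| |] // _.
rewrite -EFinD !lte_fin => fb_lt a_lt; rewrite -EFinB /=.
have [w [XE psdw cw]] := lift fX.
have e0 : 0 < a - fb by rewrite subr_gt0.
have cw01 : 0 <= c w <= 1 by rewrite cw (ltW e0) /=; lra.
have piw : frob_norm (pi w) <= 1.
  by rewrite (_ : pi w = X - Xb) ?(ltW XXb) // XE addrAC subrr add0r.
have [w' [psdw' cw'0 dist]] := errb w psdw cw01 piw.
set s := Num.sqrt (a - fb); have s0 : 0 < s by rewrite sqrtr_gt0.
have -> : derive1 phi (a - fb) = kappa / s.
  have Dpow := is_derive1_powR (1 - 2^-1) e0.
  rewrite (_ : phi = (2 * kappa) \*: (@powR R)^~ (1 - 2^-1)) // derive1E.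
  rewrite deriveZ ?derive_val; last exact: ex_derive.
  have -> : 1 - 2^-1 - 1 = - 2^-1 :> R by lra.
  rewrite powRN powR12_sqrt ?(ltW e0) // -/s /GRing.scale /=.
  by field; rewrite gt_eqF.
have lower : ((s / kappa)%:E <= dist_set 0%R (subdiff f X))%E.
  apply: le_ereal_inf_tmp => _ [G sub <-].
  have [a' + H] := subdiff_convex fNy convex_fun sub.
  rewrite fX => -[aE]; rewrite -aE in H.
  have := f_le psdw'; case fZ : (f (Xb + pi w')%R) (fNy (Xb + pi w')) => [b| |] // _.
  rewrite lee_fin cw'0 addr0 => b_le.
  have := H _ _ fZ; rewrite lee_fin sub0r frob_normN ler_pdivrMr // => Hb.
  have GX : frob_inner (- G) (pi w' - pi w) <= frob_norm G * (kappa * s).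
    apply: le_trans (frob_cauchy_schwarz _ _) _; rewrite frob_normN ler_wpM2l ?frob_norm_ge0 //.
    by rewrite -frob_normN opprB /s -cw.
  have ZX : Xb + pi w' - X = pi w' - pi w by rewrite XE opprD addrACA subrr add0r.
  rewrite ZX in Hb; rewrite frob_innerNl in GX.
  have s2 : s ^+ 2 = a - fb by rewrite sqr_sqrtr // ltW.
  rewrite -(ler_pM2r s0) -expr2 s2; lra.
apply: le_trans (lee_wpmul2l _ lower); last by rewrite lee_fin divr_ge0 // ltW.
rewrite -EFinM lee_fin.
by rewrite mulrA divfK ?gt_eqF // divff // gt_eqF.
Qed.

End Multiplier.
End Spectrahedral.

(** * Block-diagonal matrices *)

Section Blocks.
Context {R : realType} {p N : nat} {d : 'I_p -> nat}.
Implicit Types (M Y : forall k, 'M[R]_(d k)) (S T : 'M[R]_N).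

Definition stack M S : 'M[R]_(\sum_k d k + N) := block_mx (\mxdiag_k M k) 0 0 S.

Definition comp (v : 'cV[R]_(\sum_k d k + N)) k : 'cV[R]_(d k) := submxcol (usubmx v) k.

Lemma stack_mul M S v :
  stack M S *m v = col_mx (\mxcol_k (M k *m comp v k)) (S *m dsubmx v).
Proof.
rewrite -{1}[v]vsubmxK /stack mul_block_col !mul0mx addr0 add0r.
by rewrite -{1}[usubmx v]submxcolK mul_mxdiag_mxcol.
Qed.

Lemma mul_stack_eq0 M S v : stack M S *m v = 0 ->
  (forall k, M k *m comp v k = 0) /\ S *m dsubmx v = 0.
Proof.
rewrite stack_mul -(col_mx0 _ _ _ _ : col_mx 0 0 = 0 :> 'cV[R]_(_ + _)).
move=> /eq_col_mx[H ->]; split=> // k.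
have := congr1 (fun x => submxcol x k) H.
by rewrite mxcolK submxcol0.
Qed.

Lemma comp_eq0 v : (forall k, comp v k = 0) -> dsubmx v = 0 -> v = 0.
Proof.
move=> v0 w0; rewrite -[v]vsubmxK w0 -[usubmx v]submxcolK.
have -> : \mxcol_k submxcol (usubmx v) k = \mxcol_k 0.
  by apply/eq_mxcolP => k; exact: v0.
by rewrite mxcol0 col_mx0.
Qed.

Lemma stack_form M S v : frob_inner v (stack M S *m v) =
  \sum_k frob_inner (comp v k) (M k *m comp v k) + frob_inner (dsubmx v) (S *m dsubmx v).
Proof.
rewrite stack_mul -{1}[v]vsubmxK frob_inner_col_mx; congr (_ + _).
rewrite -{1}[usubmx v]submxcolK /frob_inner tr_mxcol mul_mxrow_mxcol.
by rewrite raddf_sum.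
Qed.

Lemma stackD M S Y T : stack M S + stack Y T = stack (fun k => M k + Y k) (S + T).
Proof. by rewrite /stack add_block_mx !addr0 mxdiagD. Qed.

Lemma tr_stack M S : (stack M S)^T = stack (fun k => (M k)^T) S^T.
Proof. by rewrite /stack tr_block_mx !trmx0 tr_mxdiag. Qed.

Lemma stackZ a M S : a *: stack M S = stack (fun k => a *: M k) (a *: S).
Proof.
rewrite /stack scale_block_mx !scaler0; congr block_mx.
rewrite -mul_scalar_mx -mxdiagZ {2}/mxdiag mul_mxdiag_mxblock.
apply/eq_mxblockP => i j; case: eqP => [e|_]; last by rewrite mulmx0.
by case: _ / e; rewrite !conform_mx_id mul_scalar_mx.
Qed.

Lemma eq_stack M S Y T : (forall k, M k = Y k) -> S = T -> stack M S = stack Y T.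
Proof. by move=> MY ->; congr block_mx; apply/eq_mxdiagP. Qed.

Lemma trace_stack M S : \tr (stack M S) = \sum_k \tr (M k) + \tr S.
Proof. by rewrite /stack mxtrace_block mxtrace_mxdiag. Qed.

Lemma frob_stack M S Y T : frob_inner (stack M S) (stack Y T) =
  \sum_k frob_inner (M k) (Y k) + frob_inner S T.
Proof.
rewrite /frob_inner tr_stack /stack mulmx_block !mul0mx !mulmx0 !addr0 add0r.
rewrite mxtrace_block {2}/mxdiag mul_mxdiag_mxblock mxtrace_mxblock; congr (_ + _).
by apply: eq_bigr => k _; rewrite eqxx conform_mx_id.
Qed.

Lemma psd_stack M S : psdmx (stack M S) <-> (forall k, psdmx (M k)) /\ psdmx S.
Proof.
split=> [/psdmxP[sMS pMS]|[pM pS]]; last first.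
  apply/psdmxP; split=> [|v].
    by rewrite tr_stack; apply: eq_stack => [k|]; exact: psdmx_sym.
  rewrite stack_form; apply: addr_ge0; last exact: psdmx_form_ge0.
  by apply: sumr_ge0 => k _; exact: psdmx_form_ge0.
move: sMS; rewrite tr_stack /stack => /eq_block_mx[/eq_mxdiagP sM _ _ sS].
split=> [k|].
  apply/psdmxP; split; first exact: sM.
  (* [conform_mx] only transports [u] to the size [d j]; it is the identity at [j = k]. *)
  move=> u; have := pMS (col_mx (\mxcol_j (if j == k then conform_mx 0 u else 0)) 0).
  rewrite stack_form col_mxKd mulmx0 frob_inner0r addr0 (bigD1 k) //=.
  rewrite /comp !col_mxKu mxcolK eqxx conform_mx_id big1 ?addr0 // => j /negPf jk.
  by rewrite mxcolK jk frob_inner0l.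
apply/psdmxP; split => // u; have := pMS (col_mx 0 u).
rewrite stack_form col_mxKd big1 ?add0r // => k _.
by rewrite /comp col_mxKu submxcol0 frob_inner0l.
Qed.

Lemma pd_stack M S : (forall k, pdmx (M k)) -> pdmx S -> pdmx (stack M S).
Proof.
move=> pM pS; have psd : psdmx (stack M S).
  by apply/psd_stack; split => [k|]; exact: pdmx_psd.
apply/pdmxP; split=> [|v v0]; first exact: psdmx_sym.
rewrite lt_def psdmx_form_ge0 // andbT; apply: contra_neq v0 => /(psd_kernel psd).
move=> /mul_stack_eq0[Mv Sv].
apply: comp_eq0 => [k|]; apply/eqP; apply: contraT => v0.
  have [_ /(_ _ v0)] := iffLR (pdmxP _) (pM k).
  by rewrite Mv frob_inner0r ltxx.
have [_ /(_ _ v0)] := iffLR (pdmxP _) pS.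
by rewrite Sv frob_inner0r ltxx.
Qed.

End Blocks.

(** * Duality for the nuclear norm *)

Section NuclearDuality.
Context {R : realType} {m n : nat}.
Implicit Types (X W : 'M[R]_(m, n)).

(** Weak duality against the optimal [W] for [X]. *)
Lemma nuclear_norm_le X U V :
  psdmx (nuclear_lmi X U V) -> nuclear_norm X <= (\tr U + \tr V) / 2.
Proof.
have [W [_ [_ [_ pW [_ WX] _]]]] := nuclear_multiplier X.
move=> /(psd_frob_ge0 pW); rewrite frob_nuclear_mult WX; lra.
Qed.

Lemma nuclear_norm_ge X W : psdmx (nuclear_mult W) -> frob_inner W X <= nuclear_norm X.
Proof.
have [_ [U [V [pM _ [UV _] _]]]] := nuclear_multiplier X.
move=> /psd_frob_ge0 /(_ pM); rewrite frob_nuclear_mult UV; lra.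
Qed.

(** The norm is a maximum of linear functionals; the one attaining it at [X] cuts out the required
    neighborhood. *)
Lemma nuclear_norm_lsc : lower_semicontinuous (fun X => (nuclear_norm X)%:E).
Proof.
move=> X a; rewrite lte_fin => aX.
have [W [_ [_ [_ pW [_ WX] _]]]] := nuclear_multiplier X.
exists [set Z | a < frob_inner W Z].
  apply: (@open_nbhs_nbhs _ X); split; last by rewrite /= WX.
  apply: (@open_comp _ _ (frob_inner W) [set y | a < y]); last exact: open_gt.
  by move=> Z _; exact: linear_mx_continuous.
by move=> Z /= aZ; rewrite lte_fin; apply: lt_le_trans aZ _; exact: nuclear_norm_ge.
Qed.

(** The cross term is at least [- |X| (|u|^2 + |w|^2)]. This gives the nuclear block a Slater point
    above any [X]. *)
Lemma nuclear_lmi_pd X (s : R) : frob_norm X < s -> pdmx (nuclear_lmi X s%:M s%:M).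
Proof.
move=> Xs; apply/pdmxP; split.
  by rewrite /nuclear_lmi tr_block_mx !tr_scalar_mx trmxK.
move=> v v0; have : 0 < frob_inner v v by rewrite frob_inner_gt0.
rewrite -[v]vsubmxK; move: (usubmx v) (dsubmx v) => u w {v v0}.
rewrite /nuclear_lmi mul_block_col !mul_scalar_mx !frob_inner_col_mx.
rewrite !frob_innerDr !frob_innerZr.
have -> : frob_inner w (X^T *m u) = frob_inner u (X *m w).
  by rewrite -frob_inner_mull frob_innerC.
have H : - (frob_norm X * frob_norm u * frob_norm w) <= frob_inner u (X *m w).
  rewrite lerNl -frob_innerNl; apply: le_trans (frob_cauchy_schwarz _ _) _.
  by rewrite frob_normN [frob_norm X * _]mulrC -mulrA ler_wpM2l ?frob_norm_ge0 ?frob_norm_mulmx.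
rewrite -!frob_norm_sqr; move: (frob_norm u) (frob_norm w) (frob_inner u _) H
  (frob_norm_ge0 X) Xs => x y z.
move: (frob_norm X) => k H k0 ks xy.
have : k * (x ^+ 2 + y ^+ 2) < s * (x ^+ 2 + y ^+ 2) by rewrite ltr_pM2r.
have := mulr_ge0 k0 (sqr_ge0 (x - y)); nra.
Qed.

End NuclearDuality.

(** * Lower semicontinuity *)

Section LowerSemicontinuity.
Context {R : realType} {T : topologicalType}.
Implicit Types f g : T -> \bar R.

Lemma lower_semicontinuousD f g : (forall x, f x != -oo%E) -> (forall x, g x != -oo%E) ->
  lower_semicontinuous f -> lower_semicontinuous g ->
  lower_semicontinuous (fun x => f x + g x)%E.
Proof.
move=> fNy gNy lf lg x a a_lt.
have [b [b_lt ab_lt]] : exists b : R, (b%:E < f x)%E /\ ((a - b)%:E < g x)%E.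
  case: (f x) (g x) (fNy x) (gNy x) a_lt => [r| |] [s| |] //= _ _ a_lt.
  - exists (r - (r + s - a) / 2); rewrite -EFinD !lte_fin in a_lt *; split; lra.
  - by exists (r - 1); rewrite ltry lte_fin; split => //; lra.
  - by exists (a - s + 1); rewrite ltry lte_fin; split => //; lra.
  - by exists 0; rewrite !ltry.
have [V xV Vf] := lf x b b_lt; have [V' xV' Vg] := lg x _ ab_lt.
exists (V `&` V'); first exact: filterI.
move=> y [Vy V'y]; rewrite (_ : a = b + (a - b)); last by ring.
by rewrite EFinD lteD ?Vf ?Vg.
Qed.

Lemma lower_semicontinuous_sum (I : Type) (r : seq I) (F : I -> T -> \bar R) :
  (forall i x, F i x != -oo%E) -> (forall i, lower_semicontinuous (F i)) ->
  lower_semicontinuous (fun x => \sum_(i <- r) F i x)%E /\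
  forall x, (\sum_(i <- r) F i x != -oo)%E.
Proof.
move=> FNy lF; elim: r => [|i r [IH1 IH2]].
  split=> [x a|x]; rewrite big_nil //.
  by move=> a0; exists setT => [|y _]; [exact: filterT | rewrite big_nil].
split=> [|x]; last by rewrite big_cons adde_eq_ninfty negb_or FNy IH2.
have -> : (fun x => \sum_(j <- i :: r) F j x)%E = (fun x => F i x + \sum_(j <- r) F j x)%E.
  by apply/funext => x; rewrite big_cons.
exact: lower_semicontinuousD.
Qed.

Lemma fin_num_sum (I : finType) (F : I -> \bar R) : (forall i, F i != -oo%E) ->
  (\sum_i F i < +oo)%E -> forall i, F i = (fine (F i))%:E.
Proof.
move=> FNy sF i; rewrite fineK // fin_numE FNy /=.
apply/negP => /eqP Fi; move: sF; rewrite (bigD1 i) //= Fi addye ?ltxx //.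
by elim/big_ind : _ => // x y; rewrite adde_eq_ninfty negb_or => -> ->.
Qed.

End LowerSemicontinuity.

(** * The semidefinite lift of f *)

Section Assembly.
Context {R : realType} {m n p : nat}.
Variables (d : 'I_p -> nat) (A00 A0 : forall k : 'I_p, 'M[R]_(d k)).
Variable A : forall k : 'I_p, 'I_m -> 'I_n -> 'M[R]_(d k).

Definition dlmi k (X : 'M[R]_(m, n)) (t : R) : 'M[R]_(d k) :=
  \sum_i \sum_j X i j *: A k i j + t *: A0 k.

Lemma dlmi_linear k (a : R) X Y t s :
  dlmi k (a *: X + Y) (a * t + s) = a *: dlmi k X t + dlmi k Y s.
Proof.
rewrite /dlmi scalerDr addrACA scalerDl scalerA; congr (_ + _).
rewrite scaler_sumr -big_split; apply: eq_bigr => i _ /=.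
rewrite scaler_sumr -big_split; apply: eq_bigr => j _ /=.
by rewrite !mxE scalerDl scalerA.
Qed.

Lemma lmiD k X Y t s :
  lmi (A00 k) (A k) (A0 k) (X + Y) (t + s) =
  lmi (A00 k) (A k) (A0 k) X t + dlmi k Y s.
Proof.
have := dlmi_linear k 1 X Y t s; rewrite !scale1r mul1r /dlmi /lmi => H.
by rewrite -addrA H !addrA.
Qed.

(* Lift variables (X, t, U, V): t collects the epigraph variables of the fk, and
   U, V those of the representation of the nuclear norm. *)
Let Zt := ('M[R]_(m, n) * 'rV[R]_p * 'M[R]_m * 'M[R]_n)%type.

(** The lift variables [U] and [V] range over all square matrices, so the lift space is a plain
    product; symmetrizing inside [lift_B] keeps its values symmetric and changes no trace. *)
Definition symm q (U : 'M[R]_q) := 2^-1 *: (U + U^T).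

Lemma symm_id q (U : 'M[R]_q) : U^T = U -> symm U = U.
Proof. by move=> UT; apply/matrixP => i j; rewrite /symm UT !mxE; field. Qed.

Lemma tr_symm q (U : 'M[R]_q) : (symm U)^T = symm U.
Proof. by apply/matrixP => i j; rewrite !mxE addrC. Qed.

Lemma trace_symm q (U : 'M[R]_q) : \tr (symm U) = \tr U.
Proof. by rewrite mxtraceZ mxtraceD mxtrace_tr; field. Qed.

Lemma symm_linear q (a : R) (U V : 'M[R]_q) : symm (a *: U + V) = a *: symm U + symm V.
Proof. by apply/matrixP => i j; rewrite !mxE; ring. Qed.

Definition lift_B (w : Zt) : 'M[R]_(\sum_k d k + (m + n)) :=
  stack (fun k => dlmi k w.1.1.1 (w.1.1.2 0 k))
        (nuclear_lmi w.1.1.1 (symm w.1.2) (symm w.2)).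

Definition lift_pi (w : Zt) : 'M[R]_(m, n) := w.1.1.1.

Definition lift_c (w : Zt) : R := \sum_k w.1.1.2 0 k + (\tr w.1.2 + \tr w.2) / 2.

Lemma nuclear_lmi_linear (a : R) (X Y : 'M[R]_(m, n)) U1 U2 V1 V2 :
  nuclear_lmi (a *: X + Y) (a *: U1 + U2) (a *: V1 + V2) =
  a *: nuclear_lmi X U1 V1 + nuclear_lmi Y U2 V2.
Proof. by rewrite /nuclear_lmi scale_block_mx add_block_mx linearP. Qed.

Lemma lift_B_is_linear : linear lift_B.
Proof.
move=> a u v; rewrite /lift_B stackZ stackD; apply: eq_stack => [k|] /=.
  by rewrite -dlmi_linear !mxE.
by rewrite !symm_linear nuclear_lmi_linear.
Qed.
HB.instance Definition _ := GRing.isLinear.Build R Zt _ *:%R lift_B lift_B_is_linear.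

Lemma lift_pi_is_linear : linear lift_pi. Proof. by []. Qed.
HB.instance Definition _ := GRing.isLinear.Build R Zt _ *:%R lift_pi lift_pi_is_linear.

Lemma lift_c_is_linear : linear_for *%R lift_c.
Proof.
move=> a u v; rewrite /lift_c /= !mxtraceD !mxtraceZ.
under eq_bigr do rewrite !mxE.
by rewrite big_split -mulr_sumr /=; ring.
Qed.
HB.instance Definition _ := GRing.isLinear.Build R Zt _ *%R lift_c lift_c_is_linear.

Hypothesis A0_sym : forall k, A0 k \is symmetricmx.
Hypothesis A_sym : forall k i j, A k i j \is symmetricmx.

Lemma tr_dlmi k X t : (dlmi k X t)^T = dlmi k X t.
Proof.
rewrite /dlmi linearD linearZ /= (symmetricmxP _ (A0_sym k)); congr (_ + _).
rewrite linear_sum; apply: eq_bigr => i _; rewrite linear_sum; apply: eq_bigr => j _.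
by rewrite linearZ /= (symmetricmxP _ (A_sym k i j)).
Qed.

Lemma tr_lift_B w : (lift_B w)^T = lift_B w.
Proof.
rewrite /lift_B tr_stack; apply: eq_stack => [k|]; first exact: tr_dlmi.
by rewrite /nuclear_lmi tr_block_mx !tr_symm trmxK.
Qed.

Definition lift_G (y : forall k, 'M[R]_(d k)) (W : 'M[R]_(m, n)) : 'M[R]_(m, n) :=
  W - \sum_k \matrix_(i, j) frob_inner (y k) (A k i j).

(* The multipliers y k and (nuclear_mult W) / 2 are normalized so as to
   cancel the variables t, U and V from the Lagrangian. *)
Lemma lift_lagrange (y : forall k, 'M[R]_(d k)) (W : 'M[R]_(m, n)) w :
  (forall k, frob_inner (y k) (A0 k) = 1) ->
  lift_c w - frob_inner (stack y (2^-1 *: nuclear_mult W)) (lift_B w) =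
  frob_inner (lift_G y W) (lift_pi w).
Proof.
move=> y1; rewrite /lift_B frob_stack frob_innerZl frob_nuclear_mult !trace_symm.
have -> : \sum_k frob_inner (y k) (dlmi k w.1.1.1 (w.1.1.2 0 k)) =
    frob_inner (\sum_k \matrix_(i, j) frob_inner (y k) (A k i j)) w.1.1.1 +
    \sum_k w.1.1.2 0 k.
  rewrite frob_inner_suml -big_split; apply: eq_bigr => k _ /=.
  rewrite /dlmi frob_innerDr frob_innerZr y1 mulr1; congr (_ + _).
  rewrite [RHS]frob_innerE frob_inner_sumr; apply: eq_bigr => i _.
  rewrite frob_inner_sumr; apply: eq_bigr => j _.
  by rewrite frob_innerZr mxE mulrC.
by rewrite /lift_G frob_innerDl frob_innerNl /lift_c /lift_pi; field.
Qed.

Variables (fk : 'I_p -> 'M[R]_(m, n) -> \bar R) (f : 'M[R]_(m, n) -> \bar R).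
Hypothesis fE : forall X, f X = (\sum_(k < p) fk k X + (nuclear_norm X)%:E)%E.
Hypothesis fkNy : forall k X, fk k X != -oo%E.
Hypothesis fk_epiP : forall k X t,
  (fk k X <= t%:E)%E <-> psdmx (lmi (A00 k) (A k) (A0 k) X t).

Lemma f_neq_ninfty X : f X != -oo%E.
Proof.
rewrite fE adde_eq_ninfty negb_or andbT.
by elim/big_ind : _ => // x y; rewrite adde_eq_ninfty negb_or => -> ->.
Qed.

Lemma f_finite X a : f X = a%:E -> exists t : 'I_p -> R,
  (forall k, fk k X = (t k)%:E) /\ a = \sum_k t k + nuclear_norm X.
Proof.
rewrite fE => fX; have fin : forall k, fk k X = (fine (fk k X))%:E.
  apply: fin_num_sum => //; rewrite ltey; apply/negP => /eqP sy.
  by move: fX; rewrite sy addye.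
exists (fun k => fine (fk k X)); split => //.
by move: fX; under eq_bigr do rewrite fin; rewrite sumEFin -EFinD => -[].
Qed.

(** * The lift centered at a reference point *)

Section Reference.
Variables (Xb : 'M[R]_(m, n)) (tb : 'I_p -> R) (W : 'M[R]_(m, n)).
Variables (Ub : 'M[R]_m) (Vb : 'M[R]_n).
Hypothesis fk_Xb : forall k, fk k Xb = (tb k)%:E.
Hypothesis psd_UV : psdmx (nuclear_lmi Xb Ub Vb).
Hypothesis psd_W : psdmx (nuclear_mult W).
Hypothesis tr_UV : \tr Ub + \tr Vb = nuclear_norm Xb *+ 2.
Hypothesis W_Xb : frob_inner W Xb = nuclear_norm Xb.
Hypothesis W_strict : forall v : 'cV[R]_(m + n), nuclear_lmi Xb Ub Vb *m v = 0 ->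
  frob_inner v (nuclear_mult W *m v) = 0 -> v = 0.

Definition lift_L : 'M[R]_(\sum_k d k + (m + n)) :=
  stack (fun k => lmi (A00 k) (A k) (A0 k) Xb (tb k)) (nuclear_lmi Xb Ub Vb).

Let fb := \sum_k tb k + nuclear_norm Xb.

Lemma lmi_ref k : psdmx (lmi (A00 k) (A k) (A0 k) Xb (tb k)).
Proof. by apply/fk_epiP; rewrite fk_Xb. Qed.

Lemma psd_lift_L : psdmx lift_L.
Proof. by apply/psd_stack; split => // k; exact: lmi_ref. Qed.

Lemma UV_sym : Ub^T = Ub /\ Vb^T = Vb.
Proof.
have := psdmx_sym psd_UV; rewrite /nuclear_lmi tr_block_mx trmxK.
by move=> /eq_block_mx[].
Qed.

Lemma lift_LD (w : Zt) : lift_L + lift_B w =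
  stack (fun k => lmi (A00 k) (A k) (A0 k) (Xb + lift_pi w) (tb k + w.1.1.2 0 k))
    (nuclear_lmi (Xb + lift_pi w) (Ub + symm w.1.2) (Vb + symm w.2)).
Proof.
rewrite /lift_L stackD; apply: eq_stack => [k|]; first by rewrite lmiD.
by rewrite /nuclear_lmi add_block_mx linearD.
Qed.

Lemma lift_le (w : Zt) : psdmx (lift_L + lift_B w) ->
  (f (Xb + lift_pi w)%R <= (fb + lift_c w)%:E)%E.
Proof.
rewrite lift_LD => /psd_stack[psdk /nuclear_norm_le nuc]; rewrite fE.
have -> : fb + lift_c w = \sum_k (tb k + w.1.1.2 0 k) +
    (\tr (Ub + symm w.1.2) + \tr (Vb + symm w.2)) / 2.
  rewrite big_split /= !mxtraceD !trace_symm /fb /lift_c.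
  have -> : nuclear_norm Xb = (\tr Ub + \tr Vb) / 2 by rewrite tr_UV; field.
  by field.
rewrite EFinD leeD ?lee_fin // -sumEFin; apply: lee_sum => k _.
exact/fk_epiP.
Qed.

Lemma lift_exists X a : f X = a%:E -> exists w : Zt,
  [/\ X = Xb + lift_pi w, psdmx (lift_L + lift_B w) & lift_c w = a - fb].
Proof.
move=> /f_finite[t [ft ->]].
have [_ [U [V [psdUV _ [trUV _] _]]]] := nuclear_multiplier X.
have [sU sV] : U^T = U /\ V^T = V.
  by have := psdmx_sym psdUV; rewrite /nuclear_lmi tr_block_mx trmxK => /eq_block_mx[].
have [sUb sVb] := UV_sym.
exists (X - Xb, \row_k (t k - tb k), U - Ub, V - Vb); rewrite lift_LD /lift_pi /=.
rewrite !symm_id ?linearB /= ?sU ?sUb ?sV ?sVb // !(addrC _ (_ - _)) !subrK.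
split => //.
  apply/psd_stack; split => // k.
  rewrite !mxE addrC subrK; apply/fk_epiP; by rewrite ft.
rewrite /lift_c /=; under eq_bigr do rewrite !mxE.
rewrite sumrB !linearB /= /fb.
have -> : nuclear_norm X = (\tr U + \tr V) / 2 by rewrite trUV; field.
have -> : nuclear_norm Xb = (\tr Ub + \tr Vb) / 2 by rewrite tr_UV; field.
by field.
Qed.

Section Slater.
Hypothesis slater : exists (Xs : 'M[R]_(m, n)) (ss : 'I_p -> R),
  forall k, pdmx (lmi (A00 k) (A k) (A0 k) Xs (ss k)).

Lemma lift_slater : exists w : Zt, pdmx (lift_L + lift_B w).
Proof.
have [Xs [ss pdk]] := slater; have [sUb sVb] := UV_sym.
pose s := frob_norm Xs + 1.
exists (Xs - Xb, \row_k (ss k - tb k), s%:M - Ub, s%:M - Vb).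
rewrite lift_LD /lift_pi /=.
rewrite !symm_id ?linearB /= ?tr_scalar_mx ?sUb ?sVb // !(addrC _ (_ - _)) !subrK.
apply: pd_stack => [k|]; first by rewrite !mxE addrC subrK.
by apply: nuclear_lmi_pd; rewrite /s ltrDl.
Qed.

Hypothesis sub0 : subgrad f Xb fb 0.

(** Epigraphs are closed under increasing the last variable; dividing the matrix inequality by an
    unbounded increment leaves [A0 k]. *)
Lemma A0_psd k : psdmx (A0 k).
Proof.
apply/psdmxP; split=> [|v]; first exact/symmetricmxP.
rewrite -oppr_le0.
apply: (@le0_of_small _ _ (frob_inner v (lmi (A00 k) (A k) (A0 k) Xb (tb k) *m v))) => t t0.
have : psdmx (lmi (A00 k) (A k) (A0 k) Xb (tb k + t^-1)).
  by apply/fk_epiP; rewrite fk_Xb lee_fin lerDl invr_ge0 ltW.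
move=> /(psdmx_form_ge0 v); rewrite -{1}[Xb]addr0 lmiD /dlmi big1 => [|i _]; last first.
  by rewrite big1 // => j _; rewrite mxE scale0r.
rewrite add0r mulmxDl frob_innerDr -scalemxAl frob_innerZr => H.
have := mulr_ge0 (ltW t0) H; rewrite mulrDr mulrA mulfV ?gt_eqF // mul1r; lra.
Qed.

(* Otherwise t k could be decreased to first order at no cost, against the
   minimality of Xb. *)
Lemma A0_pos k (P : 'M[R]_(d k)) : psdmx P ->
  (forall v : 'cV[R]_(d k), lmi (A00 k) (A k) (A0 k) Xb (tb k) *m v = 0 -> P *m v = v) ->
  0 < frob_inner P (A0 k).
Proof.
move=> psdP kerP; have psdA0 := A0_psd k.
rewrite lt_def psd_frob_ge0 // andbT.
apply/negP => /eqP PA0.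
have A0P : A0 k *m P = 0.
  by apply: psd_frob_eq0; rewrite // frob_innerC.
have [sigma pds] := lift_slater.
(* Here [lift_c w = -1], and [w] is tangent because [A0 k] would vanish on the kernel of the k-th
   block. *)
pose w : Zt := (0, - delta_mx 0 k, 0, 0).
have Kw : tangent lift_L lift_B w.
  move=> v /mul_stack_eq0[Lv _]; rewrite /lift_B stack_form /=.
  have symm0 q : symm (0 : 'M[R]_q) = 0 by rewrite symm_id ?trmx0.
  rewrite /nuclear_lmi !symm0 trmx0 block_mx0 mul0mx frob_inner0r addr0.
  rewrite big1 // => j _; rewrite /dlmi big1 => [|i _]; last first.
    by rewrite big1 // => j' _; rewrite mxE scale0r.
  rewrite add0r !mxE eqxx /=; case: eqP => [jk|_]; last first.
    by rewrite oppr0 scale0r mul0mx frob_inner0r.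
  by subst j; rewrite -scalemxAl -(kerP _ (Lv k)) mulmxA A0P mul0mx scaler0 frob_inner0r.
have := tangent_ge0 psd_lift_L tr_lift_B lift_le pds sub0 Kw.
rewrite /w /= /lift_c /= !mxtrace0 addr0 mul0r addr0.
under eq_bigr do rewrite !mxE eqxx /=.
rewrite sumrN oppr_ge0 (bigD1 k) //= eqxx big1 ?addr0 => [|j /negPf ->] //.
by rewrite ler10.
Qed.

Lemma psd1 q : psdmx (1%:M : 'M[R]_q).
Proof.
by apply/psdmxP; split=> [|v]; [exact: trmx1 | rewrite mul1mx frob_inner_ge0].
Qed.

(** With multiples of the identity as multipliers, and [W = 0], [Y] is positive definite, so
    [<Y, S>] controls the trace of [S], while the Lagrangian identity expresses it through
    [lift_c w] and [lift_pi w] alone. *)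
Lemma lift_trace_bound : exists2 C : R, 0 <= C & forall w : Zt,
  psdmx (lift_L + lift_B w) -> 0 <= lift_c w ->
  \tr (lift_L + lift_B w) <= C * (1 + lift_c w + frob_norm (lift_pi w)).
Proof.
pose a k := frob_inner 1%:M (A0 k).
have a0 k : 0 < a k by apply: A0_pos; [exact: psd1 | move=> v _; rewrite mul1mx].
pose y k : 'M[R]_(d k) := (a k)^-1 *: 1%:M.
pose Y := stack y (2^-1 *: nuclear_mult (0 : 'M[R]_(m, n))).
(* The blocks of [Y] carry the weights [1 / a k] and [1 / 2]; [K] dominates all their inverses. *)
pose K := \sum_k a k + 2.
have K0 : 0 <= K by rewrite addr_ge0 // sumr_ge0 // => k _; rewrite ltW.
have nm1 : nuclear_mult (0 : 'M[R]_(m, n)) = 1%:M.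
  by rewrite /nuclear_mult /nuclear_lmi oppr0 trmx0 -scalar_mx_block.
have trE q (S : 'M[R]_q) : frob_inner 1%:M S = \tr S.
  by rewrite /frob_inner trmx1 mul1mx.
exists (K * (1 + `|frob_inner Y lift_L| + frob_norm (lift_G y 0))).
  by rewrite mulr_ge0 // !addr_ge0 // frob_norm_ge0.
move=> w psdw cw0.
have trY : \tr (lift_L + lift_B w) <= K * frob_inner Y (lift_L + lift_B w).
  move: psdw; rewrite lift_LD => /psd_stack[psdk psdN].
  rewrite trace_stack /Y frob_stack nm1 mulrDr mulr_sumr; apply: lerD.
    apply: ler_sum => k _; rewrite frob_innerZl trE mulrA.
    apply: ler_peMl; first exact: psd_trace_ge0.
    rewrite ler_pdivlMr // mul1r /K (bigD1 k) //= -addrA lerDl addr_ge0 //.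
    by apply: sumr_ge0 => j _; rewrite ltW.
  rewrite frob_innerZl trE mulrA; apply: ler_peMl; first exact: psd_trace_ge0.
  by rewrite ler_pdivlMr // mul1r /K lerDr sumr_ge0 // => k _; rewrite ltW.
apply: le_trans trY _; rewrite -mulrA ler_wpM2l //.
have y1 k : frob_inner (y k) (A0 k) = 1.
  by rewrite frob_innerZl mulVf // gt_eqF.
have := lift_lagrange 0 w y1; rewrite -/Y frob_innerDr => H.
have := frob_cauchy_schwarz (- lift_G y 0) (lift_pi w).
rewrite frob_normN frob_innerNl -H.
have := ler_norm (frob_inner Y lift_L).
have := frob_norm_ge0 (lift_pi w); have := frob_norm_ge0 (lift_G y 0).
have := normr_ge0 (frob_inner Y lift_L); nra.
Qed.

(** The projection onto the kernel of each block is complementary to the block and definite on its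
    kernel; [A0_pos] allows the scaling that cancels [t]. Nothing is imposed on the coefficient of
    [X], which becomes [G]. *)
Lemma lift_multiplier : exists (Y : 'M[R]_(\sum_k d k + (m + n))) (G : 'M[R]_(m, n)),
  [/\ psdmx Y, frob_inner Y lift_L = 0,
    (forall v : 'cV[R]_(\sum_k d k + (m + n)), lift_L *m v = 0 ->
      frob_inner v (Y *m v) = 0 -> v = 0)
    & forall w : Zt, lift_c w - frob_inner Y (lift_B w) = frob_inner G (lift_pi w)].
Proof.
have exP k : exists P : 'M[R]_(d k), [/\ psdmx P,
    lmi (A00 k) (A k) (A0 k) Xb (tb k) *m P = 0 &
    forall v : 'cV[R]_(d k), lmi (A00 k) (A k) (A0 k) Xb (tb k) *m v = 0 -> P *m v = v].
  have [P [mu [sP PP LP mu0 Lmu]]] := psd_kernel_projection (lmi_ref k).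
  exists P; split => // [|v]; last exact: kernel_proj mu0 Lmu _ _.
  apply/psdmxP; split => // v.
  by rewrite -PP -mulmxA -{1}sP -frob_inner_mull frob_inner_ge0.
pose P k := projT1 (cid (exP k)).
have psdP k : psdmx (P k) by have [] := projT2 (cid (exP k)).
have LP k : lmi (A00 k) (A k) (A0 k) Xb (tb k) *m P k = 0.
  by have [] := projT2 (cid (exP k)).
have kerP k (v : 'cV[R]_(d k)) : lmi (A00 k) (A k) (A0 k) Xb (tb k) *m v = 0 -> P k *m v = v.
  by have [_ _] := projT2 (cid (exP k)); apply.
clearbody P.
have a0 k : 0 < frob_inner (P k) (A0 k) by apply: A0_pos => // v; exact: kerP.
pose y k := (frob_inner (P k) (A0 k))^-1 *: P k.
have psd_scale q (c : R) (S : 'M[R]_q) : 0 <= c -> psdmx S -> psdmx (c *: S).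
  move=> c0 pS; apply/psdmxP; split; first by rewrite linearZ /= (psdmx_sym pS).
  by move=> v; rewrite -scalemxAl frob_innerZr mulr_ge0 // psdmx_form_ge0.
have psdy k : psdmx (y k) by apply: psd_scale; rewrite // invr_ge0 ltW.
have psdW2 : psdmx (2^-1 *: nuclear_mult W) by apply: psd_scale.
exists (stack y (2^-1 *: nuclear_mult W)), (lift_G y W); split.
- exact/psd_stack.
- rewrite /lift_L frob_stack frob_innerZl frob_nuclear_mult tr_UV W_Xb subrr mulr0.
  rewrite addr0 big1 // => k _; rewrite frob_innerC frob_innerZr /frob_inner.
  by rewrite (psdmx_sym (lmi_ref k)) LP mxtrace0 mulr0.
- move=> v /mul_stack_eq0[Lv Nv]; rewrite stack_form => /eqP.
  rewrite paddr_eq0 ?psdmx_form_ge0 //; last first.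
    by apply: sumr_ge0 => k _; exact: psdmx_form_ge0.
  move=> /andP[]; rewrite psumr_eq0; last by move=> k _; exact: psdmx_form_ge0.
  move=> /allP vk /eqP v0; apply: comp_eq0 => [k|].
    have := vk k (mem_index_enum _); rewrite /= /y -scalemxAl frob_innerZr kerP //.
    by rewrite mulf_eq0 invr_eq0 gt_eqF //= frob_inner_eq0 => /eqP.
  apply: W_strict => //; move/eqP: v0.
  by rewrite -scalemxAl frob_innerZr mulf_eq0 invr_eq0 pnatr_eq0 /= => /eqP.
- by move=> w; apply: lift_lagrange => k; rewrite frob_innerZl mulVf // gt_eqF.
Qed.

End Slater.
End Reference.
End Assembly.

(** * Application of the abstract KL criterion to the semidefinite lift *)

Unset Implicit Arguments.
Set Strict Implicit.
Set Printing Implicit Defensive.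

Theorem theorem4p3 (R : realType) (m n p : nat)
    (fk : 'I_p -> 'M[R]_(m, n) -> \bar R)
    (d : 'I_p -> nat)
    (A00 : forall k : 'I_p, 'M[R]_(d k))
    (A0 : forall k : 'I_p, 'M[R]_(d k))
    (A : forall k : 'I_p, 'I_m -> 'I_n -> 'M[R]_(d k))
    (f : 'M[R]_(m, n) -> \bar R)
    (fE : forall X, f X = (\sum_(k < p) fk k X + (nuclear_norm X)%:E)%E)
    (fk_proper : forall k, proper_fun (fk k))
    (fk_closed : forall k, lower_semicontinuous (fk k))
    (A00_sym : forall k, A00 k \is symmetricmx)
    (A0_sym : forall k, A0 k \is symmetricmx)
    (A_sym : forall k i j, A k i j \is symmetricmx)
    (fk_epi : forall k,
      epi (fk k) = [set q | psdmx (lmi (A00 k) (A k) (A0 k) q.1 q.2)])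
    (slater : exists (Xs : 'M[R]_(m, n)) (ss : 'I_p -> R),
      forall k, pdmx (lmi (A00 k) (A k) (A0 k) Xs (ss k)))
    (Xbar : 'M[R]_(m, n))
    (Xbar_dom : dom_subdiff f Xbar)
    (Xbar_ri : relint (subdiff f Xbar) 0) :
  KL_property f Xbar (2^-1).
Proof.
have fkNy k X : fk k X != -oo%E by have [H _] := fk_proper k.
have fk_epiP k X t : (fk k X <= t%:E)%E <-> psdmx (lmi (A00 k) (A k) (A0 k) X t).
  by have := congr1 (fun S => S (X, t)) (fk_epi k) => /= E; rewrite -E.
have fNy := f_neq_ninfty fE fkNy.
have [a fXbar] : exists a, f Xbar = a%:E.
  have [G [fX _]] := Xbar_dom.
  by case: (f Xbar) fX (fNy Xbar) => [a| |] //; exists a.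
have [tb [fk_tb aE]] := f_finite fE fkNy fXbar.
have [W [Ub [Vb [psdUV psdW [trUV WX] Wstrict]]]] := nuclear_multiplier Xbar.
rewrite aE in fXbar.
have psdL := psd_lift_L fk_epiP fk_tb psdUV.
have symB := tr_lift_B A0_sym A_sym.
have f_le w := lift_le fE fk_epiP (tb := tb) trUV (w := w).
have lift := lift_exists fE fkNy fk_epiP tb psdUV trUV.
have subE := subdiffE psdL symB fNy fXbar f_le lift.
have sub0 := iffLR (subE 0) Xbar_ri.1.
have sub_opp G : subgrad f Xbar (\sum_k tb k + nuclear_norm Xbar) G ->
    exists2 t, 0 < t & subgrad f Xbar (\sum_k tb k + nuclear_norm Xbar) (- t *: G).
  by move=> /subE /(relint_opp Xbar_ri)[t t0 /subE]; exists t.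
have [sigma slater_lift] := lift_slater tb psdUV slater.
have trace_bound := lift_trace_bound A0_sym A_sym fE fk_epiP fk_tb psdUV trUV slater sub0.
have [Y [G [psdY YL Ypos lagrange]]] := lift_multiplier A0_sym A_sym fE fk_epiP
  fk_tb psdUV psdW trUV WX Wstrict slater sub0.
have [P [mu [sP _ LP mu0 Lmu]]] := psd_kernel_projection psdL.
apply: (KL_half_of_multiplier psdL symB fNy fXbar f_le slater_lift lift sub0 sub_opp
  psdY YL Ypos trace_bound lagrange sP LP mu0 Lmu).
have -> : f = (fun X => \sum_(k < p) fk k X + (nuclear_norm X)%:E)%E by exact/funext.
have [lsc_sum sum_Ny] := @lower_semicontinuous_sum R _ _ (index_enum 'I_p) fk fkNy fk_closed.
by apply: lower_semicontinuousD => //; exact: nuclear_norm_lsc.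
Qed.
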